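(* Let $(X,\mathcal{T},(I_i)_{i\in\mathbb{N}})$ be a computable topological space. Let $S$ and $T$ be semicomputable sets in this space such that $T\subseteq S$, and let $x\in S$. Suppose there exist $n\in\mathbb{N}\setminus\{0\}$, a neighborhood $N$ of $x$ in $S$ and a homeomorphism $f:\mathbb{H}^n\to N$ such that $x\in f(\mathrm{Bd}\,\mathbb{H}^n)$ and $f(\mathrm{Bd}\,\mathbb{H}^n)=N\cap T$. Then $S$ is c.e. at $x$.
   Context: Fix a computably finite valued function $j\mapsto[j]$ from $\mathbb{N}$ onto the nonempty finite subsets of $\mathbb{N}$ ($\{(j,i): i\in[j]\}$ computable and $[j]\subseteq\{0,\dots,\varphi(j)\}$ for a computable $\varphi$). A computable topological space is a triple $(X,\mathcal{T},(I_i))$ with $(X,\mathcal{T})$ a topological space, $\{I_i\}\subseteq\mathcal{T}$ a basis, and c.e. sets $\mathcal{C},\mathcal{D}\subseteq\mathbb{N}^2$ such that: (1) $(i,j)\in\mathcal{D}\Rightarrow I_i\cap I_j=\emptyset$; (2) $(i,j)\in\mathcal{C}\Rightarrow I_i\subseteq I_j$; (3) for $x\neq y$ there are $i,j$ with $x\in I_i$, $y\in I_j$, $(i,j)\in\mathcal{D}$; (4) if $x\in I_i\cap I_j$ there is $k$ with $x\in I_k$ and $(k,i),(k,j)\in\mathcal{C}$. Let $J_j=\bigcup_{i\in[j]}I_i$. A compact set $S$ is semicomputable if $\{j: S\subseteq J_j\}$ is c.e. For $A\subseteq S\subseteq X$, $A$ is c.e. up to $S$ if there is a c.e. $\Omega\subseteq\mathbb{N}$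 such that for each $i$: $I_i\cap A\neq\emptyset\Rightarrow i\in\Omega$, and $i\in\Omega\Rightarrow I_i\cap S\neq\emptyset$. For $x\in S$, $S$ is c.e. at $x$ if some neighborhood of $x$ in $S$ is c.e. up to $S$. $\mathbb{H}^n=\{(x_1,\dots,x_n)\in\mathbb{R}^n: x_n\ge0\}$, $\mathrm{Bd}\,\mathbb{H}^n=\{x\in\mathbb{R}^n: x_n=0\}$. *)

(* Defs.v *)
From HB Require Import structures.
From mathcomp Require Import all_boot all_order all_algebra.
From mathcomp Require Import all_classical all_reals all_analysis.

Set Implicit Arguments.
Unset Strict Implicit.
Unset Printing Implicit Defensive.

Import Order.TTheory GRing.Theory Num.Theory.
Import numFieldNormedType.Exports.

Local Open Scope classical_set_scope.
Local Open Scope ring_scope.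

(* Kleene's class of total recursive functions: the initial functions, closed
   under composition, primitive recursion and minimization of functions having
   a zero for every value of the parameters. Each clause is stated up to
   pointwise equality. *)
Inductive recursive : forall k, (k.-tuple nat -> nat) -> Prop :=
| recursive_zero k (h : k.-tuple nat -> nat) :
    (forall v, h v = 0%N) -> recursive h
| recursive_succ (h : 1.-tuple nat -> nat) :
    (forall m, h [tuple m] = m.+1) -> recursive h
| recursive_proj k (i : 'I_k) (h : k.-tuple nat -> nat) :
    (forall v, h v = tnth v i) -> recursive h
| recursive_comp k m (f : m.-tuple nat -> nat)
    (g : 'I_m -> k.-tuple nat -> nat) (h : k.-tuple nat -> nat) :
    recursive f -> (forall i, recursive (g i)) ->
    (forall v, h v = f [tuple g i v | i < m]) -> recursive h
| recursive_prec k (f : k.-tuple nat -> nat) (g : k.+2.-tuple nat -> nat)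
    (h : k.+1.-tuple nat -> nat) :
    recursive f -> recursive g ->
    (forall v : k.-tuple nat, h [tuple of 0%N :: v] = f v) ->
    (forall m (v : k.-tuple nat), h [tuple of m.+1 :: v] =
                 g [tuple of m :: h [tuple of m :: v] :: v]) ->
    recursive h
| recursive_min k (f : k.+1.-tuple nat -> nat) (h : k.-tuple nat -> nat) :
    recursive f ->
    (forall v : k.-tuple nat, f [tuple of h v :: v] = 0%N) ->
    (forall (v : k.-tuple nat) m, (m < h v)%N -> f [tuple of m :: v] <> 0%N) ->
    recursive h.

Definition computable_fun (f : nat -> nat) : Prop :=
  recursive (fun v : 1.-tuple nat => f (thead v)).

Definition computable_set2 (A : set (nat * nat)) : Prop :=
  recursive (fun v : 2.-tuple nat =>
    nat_of_bool ((tnth v ord0, tnth v ord_max) \in A)).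

Definition ce_set (A : set nat) : Prop :=
  A = set0 \/ exists2 f : nat -> nat, computable_fun f & A = range f.

Definition ce_set2 (A : set (nat * nat)) : Prop :=
  A = set0 \/
  exists f g : nat -> nat,
    [/\ computable_fun f, computable_fun g & A = range (fun m => (f m, g m))].

(* [F j] is the finite set written [j] in the literature. *)
Definition finite_sets_enum (F : nat -> set nat) : Prop :=
  [/\ computable_set2 [set p : nat * nat | F p.1 p.2],
      exists2 phi : nat -> nat, computable_fun phi &
        forall j, F j `<=` [set i | (i <= phi j)%N]
    & range F = [set A : set nat | finite_set A /\ A !=set0]].

Section ComputableTopology.
Variables (X : topologicalType) (I : nat -> set X).

Record formal_relations (C D : set (nat * nat)) : Prop := FormalRelations {
  ce_C : ce_set2 C;
  ce_D : ce_set2 D;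
  formal_disjoint : forall i j, D (i, j) -> I i `&` I j = set0;
  formal_subset : forall i j, C (i, j) -> I i `<=` I j;
  formal_separation : forall x y : X, x <> y ->
    exists i j, [/\ I i x, I j y & D (i, j)];
  formal_refinement : forall (x : X) i j, (I i `&` I j) x ->
    exists k, [/\ I k x, C (k, i) & C (k, j)]
}.

Definition computable_topological_space : Prop :=
  basis (range I) /\ exists C D, formal_relations C D.

Definition semicomputable (F : nat -> set nat) (S : set X) : Prop :=
  compact S /\ ce_set [set j | S `<=` \bigcup_(i in F j) I i].

Definition ce_up_to (A S : set X) : Prop :=
  A `<=` S /\
  exists2 Omega : set nat, ce_set Omega &
    forall i, (I i `&` A !=set0 -> Omega i) /\
              (Omega i -> I i `&` S !=set0).

(* Neighborhoods need not be open. *)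
Definition neighborhood_in (S : set X) (x : X) (N : set X) : Prop :=
  [/\ S x, N `<=` S & within S (nbhs x) N].

Definition ce_at (S : set X) (x : X) : Prop :=
  S x /\ exists2 N, neighborhood_in S x N & ce_up_to N S.

End ComputableTopology.

(* [f] restricts to a homeomorphism from the subspace [A] onto the subspace
   [B]; its values outside [A] are irrelevant. *)
Definition homeomorphism_on (U V : topologicalType) (A : set U) (B : set V)
    (f : U -> V) : Prop :=
  set_bij A B f /\ {within A, continuous f} /\
  exists2 g : V -> U, (forall u, A u -> g (f u) = u) &
    {within B, continuous g}.

(* H^(n+1) and Bd H^(n+1), inside R^(n+1). *)
Definition halfspace (R : realType) (n : nat) : set 'rV[R]_n.+1 :=
  [set v | 0 <= v ord0 ord_max].

Definition bd_halfspace (R : realType) (n : nat) : set 'rV[R]_n.+1 :=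
  [set v | v ord0 ord_max = 0].

Arguments halfspace : clear implicits.
Arguments bd_halfspace : clear implicits.

(* Main.v *)
Require Import Defs.
From mathcomp Require Import all_boot all_order all_algebra.
From mathcomp Require Import all_classical all_reals all_analysis.
From Stdlib Require Import Relation_Operators.
From mathcomp Require Import zify ring lra.
Import numFieldNormedType.Exports.
Local Open Scope classical_set_scope.
Local Open Scope ring_scope.

Set Implicit Arguments.
Unset Strict Implicit.
Unset Printing Implicit Defensive.

Import Order.TTheory GRing.Theory Num.Theory.

(* Let [Q] be a cube in the chart around [x], with its bottom face on the
   boundary. If [I i] meets [S] near [x], it contains a small cube around an
   interior point [q], and the rest of [Q] is covered by the half cubes
   [y_k < q_k] and [y_k > q_k]. So there are, for each coordinate [k], finite
   unions [U_k] and [V_k] of basic sets which are formally disjoint, avoid the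
   upper, respectively lower, [k]-th face of [Q], and cover [S] together with
   [I i] and a fixed finite union covering the outside of [Q]. Such data can be
   searched for effectively, since [S] is semicomputable. The bottom face of [Q]
   comes arbitrarily close to [q]; that it avoids [V_n] is enforced by letting
   [U_n] and the outside cover [T], which is semicomputable too. Conversely, if
   such data exist and [I i] misses [S], then the [U_k] and [V_k] cover [Q],
   which is impossible by the theorem of Hurewicz and Wallman on partitions
   between opposite faces. Discretely, the latter says that the cup product of
   the coboundaries of the indicator functions of the [U_k], summed over a grid,
   is 1 modulo 2; this follows from Stokes' formula, by induction on the
   dimension. *)

(** * Recursive functions and c.e. sets *)

Lemma recursive_ext {k} {f h : k.-tuple nat -> nat} :
  recursive f -> f =1 h -> recursive h.
Proof. by move=> rf /funext <-. Qed.

Lemma recursive_nth k i : (i < k)%N ->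
  recursive (fun v : k.-tuple nat => nth 0%N v i).
Proof.
move=> ik; apply: (@recursive_proj _ (Ordinal ik)) => v.
by rewrite (tnth_nth 0%N).
Qed.

Lemma computable_funE (f : nat -> nat) :
  computable_fun f <-> recursive (fun v : 1.-tuple nat => f (nth 0%N v 0)).
Proof.
by split=> /recursive_ext; apply=> v; rewrite /thead (tnth_nth 0%N).
Qed.

Lemma recursive_comp1 k (f : nat -> nat) (g : k.-tuple nat -> nat) :
  computable_fun f -> recursive g -> recursive (fun v => f (g v)).
Proof.
move=> cf rg; apply: (recursive_comp cf (fun _ : 'I_1 => rg)) => v.
by congr f; rewrite /thead tnth_mktuple.
Qed.

Definition recursive2 (F : nat -> nat -> nat) : Prop :=
  recursive (fun v : 2.-tuple nat => F (nth 0%N v 0) (nth 0%N v 1)).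

Lemma recursive_comp2 k (F : nat -> nat -> nat) (g h : k.-tuple nat -> nat) :
  recursive2 F -> recursive g -> recursive h ->
  recursive (fun v => F (g v) (h v)).
Proof.
move=> rF rg rh.
apply: (recursive_comp (g := fun i : 'I_2 => if i == ord0 then g else h) rF).
  by move=> i; case: ifP.
move=> v; congr F.
  by rewrite -[0%N]/(val (@ord0 1)) -tnth_nth tnth_mktuple.
by rewrite -[X in nth _ _ X]/(val (@ord_max 1)) -tnth_nth tnth_mktuple.
Qed.

Lemma recursive_const k c : recursive (fun _ : k.-tuple nat => c).
Proof.
elim: c => [|c IH]; first exact: recursive_zero.
apply: (@recursive_comp1 _ succn) IH.
by apply: recursive_succ => m.
Qed.

Lemma recursive2_prec (F : nat -> nat -> nat) (f : nat -> nat)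
    (g : 3.-tuple nat -> nat) :
  computable_fun f -> recursive g ->
  (forall x, F 0%N x = f x) ->
  (forall m x, F m.+1 x = g [tuple m; F m x; x]) -> recursive2 F.
Proof.
move=> cf rg F0 FS; apply: (recursive_prec cf rg) => [v|m v] /=.
  by rewrite F0 /thead (tnth_nth 0%N).
rewrite FS; congr g; apply: val_inj => /=.
by case: v => -[|x [|]].
Qed.

Lemma recursive2_addn : recursive2 addn.
Proof.
apply: (@recursive2_prec addn id (fun v => (nth 0%N v 1).+1)) => //.
- exact/computable_funE/recursive_nth.
- by apply: (@recursive_comp1 _ succn); [exact: recursive_succ|exact: recursive_nth].
Qed.

Lemma recursive2_muln : recursive2 muln.
Proof.
apply: (@recursive2_prec muln (fun=> 0%N) (fun v => nth 0%N v 2 + nth 0%N v 1)%N) => //.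
- exact: recursive_zero.
- by apply: (recursive_comp2 recursive2_addn); exact: recursive_nth.
Qed.

Lemma computable_predn : computable_fun predn.
Proof.
apply/computable_funE.
apply: (@recursive_prec 0 (fun=> 0%N) (fun v => nth 0%N v 0)) => //.
- exact: recursive_zero.
- exact: recursive_nth.
Qed.

Lemma recursive2_subn : recursive2 subn.
Proof.
(* Primitive recursion runs on the first argument, hence the swap. *)
have rF : recursive2 (fun m x => (x - m)%N).
  apply: (@recursive2_prec _ id (fun v => (nth 0%N v 1).-1)).
  - exact/computable_funE/recursive_nth.
  - exact/(recursive_comp1 computable_predn)/recursive_nth.
  - by move=> x; rewrite subn0.
  - by move=> m x; rewrite subnS.
by apply: (recursive_comp2 rF); exact: recursive_nth.
Qed.

Lemma computable_comp {f g : nat -> nat} :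
  computable_fun f -> computable_fun g -> computable_fun (fun n => f (g n)).
Proof.
by move=> cf /computable_funE cg; apply/computable_funE/recursive_comp1.
Qed.

Lemma computable_comp2 {F : nat -> nat -> nat} {f g : nat -> nat} :
  recursive2 F -> computable_fun f -> computable_fun g ->
  computable_fun (fun n => F (f n) (g n)).
Proof.
move=> rF /computable_funE cf /computable_funE cg.
by apply/computable_funE/recursive_comp2.
Qed.

Lemma computable_id : computable_fun id.
Proof. exact/computable_funE/recursive_nth. Qed.

Lemma computable_const c : computable_fun (fun=> c).
Proof. exact: recursive_const. Qed.

Lemma computable_addn (f g : nat -> nat) : computable_fun f ->
  computable_fun g -> computable_fun (fun n => f n + g n)%N.
Proof. exact: (computable_comp2 recursive2_addn). Qed.

Lemma computable_muln (f g : nat -> nat) : computable_fun f ->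
  computable_fun g -> computable_fun (fun n => f n * g n)%N.
Proof. exact: (computable_comp2 recursive2_muln). Qed.

Lemma computable_subn (f g : nat -> nat) : computable_fun f ->
  computable_fun g -> computable_fun (fun n => f n - g n)%N.
Proof. exact: (computable_comp2 recursive2_subn). Qed.

Lemma computable_if0 (c f g : nat -> nat) : computable_fun c ->
  computable_fun f -> computable_fun g ->
  computable_fun (fun n => if c n == 0%N then f n else g n).
Proof.
move=> cc cf cg.
(* Truncated subtraction makes [1 - c n] the indicator of [c n = 0]. *)
have -> : (fun n => if c n == 0%N then f n else g n) =
    (fun n => f n * (1 - c n) + g n * (1 - (1 - c n)))%N.
  apply/funext => n; case: (c n) => [|m] /=.
    by rewrite subn0 subnn muln1 muln0 addn0.
  by rewrite subSS sub0n subn0 muln1 muln0.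
apply: computable_addn; apply: computable_muln => //;
  apply: computable_subn => //; try exact: computable_const.
by apply: computable_subn => //; exact: computable_const.
Qed.

(** * Integer square roots and pairing *)

Lemma isqrt_exists c : exists s, (c < s.+1 * s.+1)%N.
Proof. by exists c; nia. Qed.

Definition isqrt c := ex_minn (isqrt_exists c).

Lemma isqrtE s c : (s * s <= c < s.+1 * s.+1)%N -> isqrt c = s.
Proof. by move=> ?; rewrite /isqrt; case: ex_minnP => t ? /(_ s); nia. Qed.

Lemma computable_isqrt : computable_fun isqrt.
Proof.
(* The minimized function of [s] and [c] vanishes exactly when [c < (s+1)^2]. *)
apply/computable_funE; apply: (@recursive_min 1 (fun v : 2.-tuple nat =>
  (nth 0 v 1).+1 - (nth 0 v 0).+1 * (nth 0 v 0).+1)%N).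
- have rS : computable_fun succn by exact: recursive_succ.
  apply: (recursive_comp2 recursive2_subn).
    exact/(recursive_comp1 rS)/recursive_nth.
  by apply: (recursive_comp2 recursive2_muln);
     exact/(recursive_comp1 rS)/recursive_nth.
- move=> v /=; rewrite /isqrt; case: ex_minnP => s Hs _.
  by apply/eqP; rewrite subn_eq0.
- move=> v m /=; rewrite /isqrt; case: ex_minnP => s _ Hs ms.
  by move/eqP; rewrite subn_eq0 => /Hs; rewrite leqNgt ms.
Qed.

(* A number is decoded through its distance to the largest square below it,
   and through the same distance for its integer square root. *)
Definition npair (a b : nat) : nat :=
  (((a + b) * (a + b) + b) * ((a + b) * (a + b) + b) + a)%N.

Definition square_excess c : nat := (c - isqrt c * isqrt c)%N.

Definition nfst c : nat := square_excess c.

Definition nsnd c : nat := square_excess (isqrt c).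

(** With [s = a + b] and [t = s^2 + b] the code is [t^2 + a]. It stays below the next square because
    [a <= 2t]; likewise [b <= 2s] allows [b] to be decoded from [t]. *)
Lemma isqrt_npair a b : isqrt (npair a b) = ((a + b) * (a + b) + b)%N.
Proof. by apply: isqrtE; rewrite /npair; nia. Qed.

Lemma npairK1 a b : nfst (npair a b) = a.
Proof. by rewrite /nfst /square_excess isqrt_npair /npair; lia. Qed.

Lemma npairK2 a b : nsnd (npair a b) = b.
Proof.
rewrite /nsnd /square_excess isqrt_npair (@isqrtE (a + b)%N); first lia.
by nia.
Qed.

Lemma computable_square_excess : computable_fun square_excess.
Proof.
apply: computable_subn; first exact: computable_id.
by apply: computable_muln; exact: computable_isqrt.
Qed.

Lemma computable_nfst (f : nat -> nat) :
  computable_fun f -> computable_fun (fun n => nfst (f n)).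
Proof. exact/computable_comp/computable_square_excess. Qed.

Lemma computable_nsnd (f : nat -> nat) :
  computable_fun f -> computable_fun (fun n => nsnd (f n)).
Proof.
apply/computable_comp/(computable_comp computable_square_excess).
exact: computable_isqrt.
Qed.

Lemma recursive2_npair : recursive2 npair.
Proof.
have r0 : recursive (fun v : 2.-tuple nat => nth 0%N v 0) by exact: recursive_nth.
have r1 : recursive (fun v : 2.-tuple nat => nth 0%N v 1) by exact: recursive_nth.
have r01 := recursive_comp2 recursive2_addn r0 r1.
have r2 := recursive_comp2 recursive2_muln r01 r01.
have r3 := recursive_comp2 recursive2_addn r2 r1.
exact: (recursive_comp2 recursive2_addn (recursive_comp2 recursive2_muln r3 r3) r0).
Qed.

Lemma computable_npair (f g : nat -> nat) : computable_fun f ->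
  computable_fun g -> computable_fun (fun n => npair (f n) (g n)).
Proof. exact: (computable_comp2 recursive2_npair). Qed.

(** Pairing packs counter, previous value and parameter into one number, so that a recursion step
    can be given by a unary function. *)
Lemma computable_prec (h : nat -> nat -> nat) (f g b c : nat -> nat) :
  computable_fun f -> computable_fun g ->
  (forall n, h 0%N n = f n) ->
  (forall m n, h m.+1 n = g (npair m (npair (h m n) n))) ->
  computable_fun b -> computable_fun c ->
  computable_fun (fun n => h (b n) (c n)).
Proof.
move=> cf cg h0 hS; apply: computable_comp2.
apply: (recursive2_prec (f := f) (g := fun v =>
  g (npair (nth 0 v 0) (npair (nth 0 v 1) (nth 0 v 2)))%N)) => //.
apply: (recursive_comp1 cg); apply: (recursive_comp2 recursive2_npair).
  exact: recursive_nth.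
by apply: (recursive_comp2 recursive2_npair); exact: recursive_nth.
Qed.

Lemma computable_bigsum (f b c : nat -> nat) :
  computable_fun f -> computable_fun b -> computable_fun c ->
  computable_fun (fun n => \sum_(i < b n) f (npair i (c n)))%N.
Proof.
move=> cf; apply: (@computable_prec
  (fun m n => \sum_(i < m) f (npair i n))%N (fun=> 0%N)
  (fun z => nfst (nsnd z) + f (npair (nfst z) (nsnd (nsnd z))))%N).
- exact: computable_const.
- apply: computable_addn; first exact/computable_nfst/computable_nsnd/computable_id.
  apply: (computable_comp cf); apply: computable_npair.
    exact/computable_nfst/computable_id.
  exact/computable_nsnd/computable_nsnd/computable_id.
- by move=> n; rewrite big_ord0.
- by move=> m n; rewrite !(npairK1, npairK2) big_ord_recr.
Qed.

Lemma computable_bigprod (f b c : nat -> nat) :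
  computable_fun f -> computable_fun b -> computable_fun c ->
  computable_fun (fun n => \prod_(i < b n) f (npair i (c n)))%N.
Proof.
move=> cf; apply: (@computable_prec
  (fun m n => \prod_(i < m) f (npair i n))%N (fun=> 1%N)
  (fun z => nfst (nsnd z) * f (npair (nfst z) (nsnd (nsnd z))))%N).
- exact: computable_const.
- apply: computable_muln; first exact/computable_nfst/computable_nsnd/computable_id.
  apply: (computable_comp cf); apply: computable_npair.
    exact/computable_nfst/computable_id.
  exact/computable_nsnd/computable_nsnd/computable_id.
- by move=> n; rewrite big_ord0.
- by move=> m n; rewrite !(npairK1, npairK2) big_ord_recr.
Qed.

(** * Sigma-1 predicates and their closure properties *)

(** Zero sets turn conjunction into addition and disjunction into multiplication, which makes
    closure properties easier than for enumerations. *)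
Definition sigma1 (P : nat -> Prop) : Prop :=
  exists2 f, computable_fun f & forall n, P n <-> exists m, f (npair n m) = 0%N.

Lemma sigma1_ext (P Q : nat -> Prop) :
  (forall n, P n <-> Q n) -> sigma1 P -> sigma1 Q.
Proof. by move=> PQ [f cf Pf]; exists f => // n; rewrite -PQ. Qed.

Lemma sigma1_comp (P : nat -> Prop) (g : nat -> nat) :
  sigma1 P -> computable_fun g -> sigma1 (fun n => P (g n)).
Proof.
move=> [f cf Pf] cg; exists (fun z => f (npair (g (nfst z)) (nsnd z))).
  apply: (computable_comp cf); apply: computable_npair.
    exact/(computable_comp cg)/computable_nfst/computable_id.
  exact/computable_nsnd/computable_id.
move=> n; rewrite Pf; split=> -[m fm]; exists m; move: fm;
  by rewrite npairK1 npairK2.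
Qed.

Lemma sigma1_zero (g : nat -> nat) :
  computable_fun g -> sigma1 (fun n => g n = 0%N).
Proof.
move=> cg; exists (fun z => g (nfst z)).
  exact/(computable_comp cg)/computable_nfst/computable_id.
move=> n; split=> [gn|[m]]; last by rewrite npairK1.
by exists 0%N; rewrite npairK1.
Qed.

Lemma sigma1_eq (g h : nat -> nat) :
  computable_fun g -> computable_fun h -> sigma1 (fun n => g n = h n).
Proof.
move=> cg ch; apply: (@sigma1_ext (fun n => (g n - h n) + (h n - g n) = 0)%N).
  by move=> n; lia.
by apply/sigma1_zero/computable_addn; apply: computable_subn.
Qed.

Lemma sigma1_false : sigma1 (fun=> False).
Proof.
by apply: (sigma1_ext _ (sigma1_zero (computable_const 1))) => n; split.
Qed.

Lemma sigma1_true : sigma1 (fun=> True).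
Proof.
by apply: (sigma1_ext _ (sigma1_zero (computable_const 0))) => n; split.
Qed.

Lemma sigma1_and (P Q : nat -> Prop) :
  sigma1 P -> sigma1 Q -> sigma1 (fun n => P n /\ Q n).
Proof.
move=> [f cf Pf] [g cg Qg].
exists (fun z => f (npair (nfst z) (nfst (nsnd z))) +
                 g (npair (nfst z) (nsnd (nsnd z))))%N.
  apply: computable_addn; [apply: (computable_comp cf)|apply: (computable_comp cg)].
    apply: computable_npair; first exact/computable_nfst/computable_id.
    exact/computable_nfst/computable_nsnd/computable_id.
  apply: computable_npair; first exact/computable_nfst/computable_id.
  exact/computable_nsnd/computable_nsnd/computable_id.
move=> n; rewrite Pf Qg; split=> [[[p fp] [q gq]]|[m]].
  by exists (npair p q); rewrite !(npairK1, npairK2) fp gq.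
rewrite npairK1 npairK2 => /eqP; rewrite addn_eq0 => /andP[/eqP fp /eqP gq].
by split; [exists (nfst m)|exists (nsnd m)].
Qed.

Lemma sigma1_or (P Q : nat -> Prop) :
  sigma1 P -> sigma1 Q -> sigma1 (fun n => P n \/ Q n).
Proof.
move=> [f cf Pf] [g cg Qg]; exists (fun z => f z * g z)%N.
  exact: computable_muln.
move=> n; rewrite Pf Qg; split=> [[[m fm]|[m gm]]|[m /eqP]].
- by exists m; rewrite fm.
- by exists m; rewrite gm muln0.
- by rewrite muln_eq0 => /orP[] /eqP ?; [left|right]; exists m.
Qed.

Lemma sigma1_exists (P : nat -> nat -> Prop) :
  sigma1 (fun z => P (nfst z) (nsnd z)) -> sigma1 (fun n => exists y, P y n).
Proof.
move=> [f cf Pf].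
exists (fun z => f (npair (npair (nfst (nsnd z)) (nfst z)) (nsnd (nsnd z)))).
  apply: (computable_comp cf); apply: computable_npair; [apply: computable_npair|].
  - exact/computable_nfst/computable_nsnd/computable_id.
  - exact/computable_nfst/computable_id.
  - exact/computable_nsnd/computable_nsnd/computable_id.
move=> n; split=> [[y Py]|[m]].
  have /Pf[m fm] : P (nfst (npair y n)) (nsnd (npair y n)).
    by rewrite npairK1 npairK2.
  by exists (npair y m); rewrite !(npairK1, npairK2).
rewrite !(npairK1, npairK2) => fm; exists (nfst m).
have := (Pf (npair (nfst m) n)).2; rewrite npairK1 npairK2; apply.
by exists (nsnd m).
Qed.

(* Bounding the witnesses uniformly pulls the existential quantifier in
   front of the bounded universal one. *)
Lemma sigma1_forall_lt (P : nat -> nat -> Prop) (b : nat -> nat) :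
  computable_fun b -> sigma1 (fun z => P (nfst z) (nsnd z)) ->
  sigma1 (fun n => forall y, (y < b n)%N -> P y n).
Proof.
move=> cb [f cf Pf].
have {}Pf y n : P y n <-> exists m, f (npair (npair y n) m) = 0%N.
  by rewrite -Pf npairK1 npairK2.
pose f' z := f (npair (nsnd z) (nfst z)).
have cf' : computable_fun f'.
  apply: (computable_comp cf); apply: computable_npair.
    exact/computable_nsnd/computable_id.
  exact/computable_nfst/computable_id.
(* The product over [m < M] vanishes exactly when there is a witness below [M]; the sum over [y]
   used below vanishes exactly when all these products do. *)
pose g z := (\prod_(m < nsnd (nsnd z)) f' (npair m (npair (nfst z) (nfst (nsnd z)))))%N.
have cg : computable_fun g.
  apply: computable_bigprod => //.
    exact/computable_nsnd/computable_nsnd/computable_id.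
  apply: computable_npair; first exact/computable_nfst/computable_id.
  exact/computable_nfst/computable_nsnd/computable_id.
have g0 y n M : reflect (exists2 m, (m < M)%N & f (npair (npair y n) m) = 0%N)
    (g (npair y (npair n M)) == 0%N).
  rewrite /g !(npairK1, npairK2) /f'.
  apply: (iffP idP) => [|[m mM fm]]; last first.
    by rewrite (bigD1 (Ordinal mM)) //= !(npairK1, npairK2) fm.
  apply: contraTP => nf; rewrite -lt0n; apply: prodn_gt0 => m.
  rewrite lt0n !(npairK1, npairK2); apply/eqP => fm.
  by apply: nf; exists m.
exists (fun z => \sum_(y < b (nfst z)) g (npair y z))%N.
  apply: computable_bigsum => //; last exact: computable_id.
  exact/(computable_comp cb)/computable_nfst/computable_id.
move=> n; split=> [Pn|[M]]; last first.
  rewrite npairK1 => /eqP; rewrite sum_nat_eq0 => /forallP H y yb.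
  have /= /g0[m _ fm] := H (Ordinal yb).
  by apply/Pf; exists m.
(* Finitely many [y] admit a common bound on their witnesses. *)
have [M HM] : exists M, forall y, (y < b n)%N -> exists2 m, (m < M)%N &
    f (npair (npair y n) m) = 0%N.
  elim: (b n) Pn => [|k IH] Pn; first by exists 0%N.
  have [M HM] : exists M, forall y, (y < k)%N -> exists2 m, (m < M)%N &
      f (npair (npair y n) m) = 0%N.
    by apply: IH => y yk; apply: Pn; lia.
  have /Pf[m fm] := Pn k (ltnSn k).
  exists (M + m.+1)%N => y; rewrite ltnS leq_eqVlt => /predU1P[->|/HM[m' m'M fm']].
    by exists m => //; lia.
  by exists m' => //; lia.
exists M; rewrite npairK1; apply/eqP; rewrite sum_nat_eq0.
by apply/forallP => y; apply/g0/HM.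
Qed.

Lemma ce_set_sigma1 (A : set nat) : ce_set A <-> sigma1 A.
Proof.
split=> [[->|[f cf ->]]|[f cf Af]]; first exact: sigma1_false.
- apply: (@sigma1_ext (fun n => exists m, f m = n)).
    by move=> n; split=> [[m <-]|[m _ <-]]; exists m.
  apply: sigma1_exists; apply: sigma1_eq.
    exact/(computable_comp cf)/computable_nfst/computable_id.
  exact/computable_nsnd/computable_id.
- have [->|/set0P[a Aa]] := eqVneq A set0; first by left.
  (* A coded pair [(n, m)] yields [n] if [m] is a witness for it, and otherwise the default element
     [a] of [A]. *)
  right; exists (fun z => if f (npair (nfst z) (nsnd z)) == 0%N then nfst z else a).
    apply: computable_if0; [apply: (computable_comp cf)|..].
    + by apply: computable_npair;
        [exact/computable_nfst/computable_id|exact/computable_nsnd/computable_id].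
    + exact/computable_nfst/computable_id.
    + exact: computable_const.
  apply/seteqP; split=> [n /Af[m fm]|n [z _ <-]].
    by exists (npair n m) => //; rewrite npairK1 npairK2 fm.
  by case: eqP => // fz; apply/Af; exists (nsnd z).
Qed.

Definition sigma1_rel (Q : nat -> nat -> Prop) : Prop :=
  sigma1 (fun z => Q (nfst z) (nsnd z)).

Lemma sigma1_rel_comp (Q : nat -> nat -> Prop) (f g : nat -> nat) :
  sigma1_rel Q -> computable_fun f -> computable_fun g ->
  sigma1 (fun n => Q (f n) (g n)).
Proof.
move=> sQ cf cg; have := sigma1_comp sQ (computable_npair cf cg).
by apply: sigma1_ext => n; rewrite npairK1 npairK2.
Qed.

Lemma ce_set2_sigma1 (A : set (nat * nat)) :
  ce_set2 A -> sigma1_rel (fun a b => A (a, b)).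
Proof.
case=> [->|[f [g [cf cg ->]]]].
  by apply: sigma1_ext sigma1_false => n; split.
apply: (@sigma1_ext (fun z => exists m, f m = nfst z /\ g m = nsnd z)).
  move=> z; split=> [[m [fm gm]]|[m _ [fm gm]]].
    by exists m => //; rewrite fm gm.
  by exists m.
apply: sigma1_exists; apply: sigma1_and; apply: sigma1_eq.
- exact/(computable_comp cf)/computable_nfst/computable_id.
- exact/computable_nfst/computable_nsnd/computable_id.
- exact/(computable_comp cg)/computable_nfst/computable_id.
- exact/computable_nsnd/computable_nsnd/computable_id.
Qed.

Lemma sigma1_all (T : finType) (P : T -> nat -> Prop) :
  (forall k, sigma1 (P k)) -> sigma1 (fun n => forall k, P k n).
Proof.
move=> sP; apply: (@sigma1_ext (fun n => forall k, k \in enum T -> P k n)).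
  by move=> n; split=> H k => [|_]; apply: H; rewrite ?mem_enum.
elim: (enum T) => [|k s IH].
  by apply: sigma1_ext sigma1_true => n; split.
apply: sigma1_ext (sigma1_and (sP k) IH) => n; split=> [[Pk Ps] l|H].
  by rewrite inE => /predU1P[->|/Ps].
by split=> [|l ls]; apply: H; rewrite inE ?eqxx ?ls ?orbT.
Qed.

Lemma sigma1_has (T : finType) (P : T -> nat -> Prop) :
  (forall k, sigma1 (P k)) -> sigma1 (fun n => exists k, P k n).
Proof.
move=> sP; apply: (@sigma1_ext (fun n => exists2 k, k \in enum T & P k n)).
  by move=> n; split=> [[k _ Pk]|[k Pk]]; exists k; rewrite ?mem_enum.
elim: (enum T) => [|k s IH].
  by apply: sigma1_ext sigma1_false => n; split=> // -[].
apply: sigma1_ext (sigma1_or (sP k) IH) => n; split=> [[Pk|[l ls Pl]]|[l]].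
- by exists k; rewrite ?mem_head.
- by exists l; rewrite // inE ls orbT.
- by rewrite inE => /predU1P[->|ls Pl]; [left|right; exists l].
Qed.

(** * Enumerating a reflexive transitive closure *)

Section ReflexiveTransitiveClosure.
Variables f g : nat -> nat.

(* A state pairs the current endpoint with a code of the remaining steps. *)
Definition chain_step (s : nat) : nat :=
  if f (nfst (nsnd s)) == nfst s
  then npair (g (nfst (nsnd s))) (nsnd (nsnd s)) else s.

(** A state whose next coded step does not start at the current endpoint is left unchanged, so every
    run follows a genuine chain. Conversely, a chain is coded from its end backwards. *)
Lemma chain_stepP a b :
  clos_refl_trans_1n nat (fun a b => exists m, (f m, g m) = (a, b)) a b <->
  exists n c, nfst (iter n chain_step (npair a c)) = b.
Proof.
split=> [|[n [c <-]]].
  elim=> {a b}[a|a _ c [m [<- <-]] _ [n [z nz]]].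
    by exists 0%N, 0%N; rewrite npairK1.
  exists n.+1, (npair m z).
  by rewrite iterSr {2}/chain_step !(npairK1, npairK2) eqxx.
rewrite -{1}(npairK1 a c); elim: n (npair a c) => [|n IH] s.
  exact: rt1n_refl.
rewrite iterSr {2}/chain_step; case: eqP => [fs|_]; last exact: IH.
apply: rt1n_trans (IH _); exists (nfst (nsnd s)).
by rewrite fs npairK1.
Qed.

Lemma computable_iter_chain_step (b c : nat -> nat) :
  computable_fun f -> computable_fun g -> computable_fun b ->
  computable_fun c -> computable_fun (fun n => iter (b n) chain_step (c n)).
Proof.
move=> cf cg.
have cS : computable_fun chain_step.
  have c1 : computable_fun (fun s => f (nfst (nsnd s))).
    exact/(computable_comp cf)/computable_nfst/computable_nsnd/computable_id.
  have c2 : computable_fun nfst by exact/computable_nfst/computable_id.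
  have := computable_if0 (computable_addn (computable_subn c1 c2) (computable_subn c2 c1))
    (computable_npair (computable_comp cg (computable_nfst (computable_nsnd computable_id)))
       (computable_nsnd (computable_nsnd computable_id))) computable_id.
  congr computable_fun; apply/funext => s; rewrite /chain_step addn_eq0 !subn_eq0.
  by rewrite -eqn_leq.
apply: (@computable_prec (fun m s => iter m chain_step s) id
  (fun z => chain_step (nfst (nsnd z)))) => //.
- exact: computable_id.
- exact/(computable_comp cS)/computable_nfst/computable_nsnd/computable_id.
- by move=> m n; rewrite npairK2 npairK1.
Qed.

End ReflexiveTransitiveClosure.

(** The axioms make [C] neither reflexive nor transitive; its closure is a preorder which remains
    c.e. and still entails inclusion. *)
Definition formal_le (C : set (nat * nat)) : nat -> nat -> Prop :=
  clos_refl_trans_1n nat (fun a b => C (a, b)).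

Lemma sigma1_formal_le C : ce_set2 C -> sigma1_rel (formal_le C).
Proof.
case=> [->|[f [g [cf cg ->]]]].
  apply: (@sigma1_ext (fun z => nfst z = nsnd z)).
    by move=> z; split=> [->|[]//]; exact: rt1n_refl.
  by apply: sigma1_eq;
    [exact/computable_nfst/computable_id|exact/computable_nsnd/computable_id].
apply: (@sigma1_ext (fun z => exists n c,
  nfst (iter n (chain_step f g) (npair (nfst z) c)) = nsnd z)).
  move=> z; rewrite -chain_stepP /formal_le.
  suff -> : (fun a b => exists m, (f m, g m) = (a, b)) =
      (fun a b => range (fun m => (f m, g m)) (a, b)) by [].
  apply/funext => a; apply/funext => b; apply/propext.
  by split=> [[m mE]|[m _ mE]]; exists m.
do 2![apply: sigma1_exists]; apply: sigma1_eq.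
  apply/computable_nfst/computable_iter_chain_step => //.
    exact/computable_nfst/computable_nsnd/computable_id.
  apply: computable_npair; last exact/computable_nfst/computable_id.
  exact/computable_nfst/computable_nsnd/computable_nsnd/computable_id.
exact/computable_nsnd/computable_nsnd/computable_nsnd/computable_id.
Qed.

(** * Codes of finite sequences and of finite sets *)

Definition nentry (k z : nat) : nat := nfst (iter k nsnd z).

Lemma computable_nentry k (f : nat -> nat) :
  computable_fun f -> computable_fun (fun n => nentry k (f n)).
Proof.
move=> cf; apply: computable_nfst; elim: k => //= k IH.
exact: computable_nsnd.
Qed.

Lemma nentry_surj n (a : nat -> nat) :
  exists z, forall k, (k < n)%N -> nentry k z = a k.
Proof.
elim: n a => [|n IH] a; first by exists 0%N.
have [z Hz] := IH (fun k => a k.+1).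
exists (npair (a 0%N) z) => -[|k] kn; first by rewrite /nentry /= npairK1.
by rewrite /nentry iterSr npairK2; apply: Hz.
Qed.

Section FiniteSets.
Variables (F : nat -> set nat) (hF : finite_sets_enum F).

(* [F] enumerates the nonempty finite sets only; shifting the index makes
   room for the empty set. *)
Definition finset_of (u : nat) : set nat := if u is u'.+1 then F u' else set0.

Lemma recursive_mem_finset_of : exists2 chi : nat -> nat, computable_fun chi &
  forall u i, finset_of u i <-> chi (npair u i) = 0%N.
Proof.
case: hF => mF _ _.
pose G a b := nat_of_bool ((a, b) \in [set p : nat * nat | F p.1 p.2]).
have rG : recursive2 G.
  by apply: recursive_ext mF _ => v; rewrite /G !(tnth_nth 0%N).
have cGG : computable_fun (fun z => G (nfst z).-1 (nsnd z)).
  apply: (computable_comp2 rG); last exact/computable_nsnd/computable_id.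
  exact/(computable_comp computable_predn)/computable_nfst/computable_id.
exists (fun z => if nfst z == 0%N then 1%N else (1 - G (nfst z).-1 (nsnd z))%N).
  apply: computable_if0; first exact/computable_nfst/computable_id.
    exact: computable_const.
  by apply: computable_subn => //; exact: computable_const.
move=> [|u] i; rewrite npairK1 npairK2 //=; rewrite /G.
by case: (boolP (_ \in _)) => [/set_mem|/negP nF] //=; split=> // /mem_set.
Qed.

Lemma sigma1_finset_of (f g : nat -> nat) : computable_fun f ->
  computable_fun g -> sigma1 (fun n => finset_of (f n) (g n)).
Proof.
move=> cf cg; have [chi cchi chiP] := recursive_mem_finset_of.
apply: (@sigma1_ext (fun n => chi (npair (f n) (g n)) = 0%N)).
  by move=> n; rewrite chiP.
exact/sigma1_zero/(computable_comp cchi)/computable_npair.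
Qed.

Lemma sigma1_forall_finset_of (f : nat -> nat) (P : nat -> nat -> Prop) :
  computable_fun f -> sigma1_rel P ->
  sigma1 (fun n => forall i, finset_of (f n) i -> P i n).
Proof.
move=> cf sP; have [chi cchi chiP] := recursive_mem_finset_of.
case: hF => _ [phi cphi phiP] _.
(* Since [phi] bounds the members and [chi] decides membership, the quantifier becomes a bounded
   one; [1 - chi = 0] means non-membership. For the code [0] the bound is arbitrary, as there are no
   members. *)
apply: (@sigma1_ext (fun n => forall i, (i < (phi (f n).-1).+1)%N ->
  1 - chi (npair (f n) i) = 0 \/ P i n)%N).
  move=> n; split=> H i => [Fi|_].
    have [||//] := H i; last by move/chiP: Fi => ->.
    by rewrite ltnS; case: (f n) Fi => //= u; apply: phiP.
  have [/H|nF] := pselect (finset_of (f n) i); first by right.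
  by left; apply/eqP; rewrite subn_eq0 lt0n; apply/eqP => /chiP.
apply: (sigma1_forall_lt (P := fun i n => 1 - chi (npair (f n) i) = 0 \/ P i n)%N).
  apply: computable_addn (computable_const 1) _.
  exact/(computable_comp cphi)/(computable_comp computable_predn).
apply: sigma1_or => //; apply/sigma1_zero/computable_subn.
  exact: computable_const.
apply: (computable_comp cchi); apply: computable_npair.
  exact/(computable_comp cf)/computable_nsnd/computable_id.
exact/computable_nfst/computable_id.
Qed.

Lemma finset_of_surj (A : set nat) : finite_set A -> exists u, finset_of u = A.
Proof.
move=> fA; have [->|/set0P A0] := eqVneq A set0; first by exists 0%N.
case: hF => _ _ /seteqP[_ /(_ A)] []; first by [].
by move=> u _ uA; exists u.+1.
Qed.

Lemma finite_finset_of u : finite_set (finset_of u).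
Proof.
case: u => [|u] /=; first exact: finite_set0.
case: hF => _ _ /seteqP[/(_ (F u)) H _].
by case: H => //; exists u.
Qed.

Lemma finite_enum_surj (A : set nat) : finite_set A -> A !=set0 ->
  exists j, F j = A.
Proof.
move=> fA A0; case: hF => _ _ /seteqP[_ /(_ A)] []; first by [].
by move=> j _ jA; exists j.
Qed.

End FiniteSets.

(** * The mod 2 degree on a grid *)

Section GridDegree.
Variables (K : comNzRingType) (K2 : forall x : K, x + x = 0).

Definition point := nat -> nat.

Definition incr (k : nat) (v : point) : point := fun i => (v i + (i == k))%N.

Definition upd (v : point) (k t : nat) : point := fun i => if i == k then t else v i.

Definition del (k : nat) (L : seq nat) := [seq l <- L | l != k].

Lemma delC k l L : del k (del l L) = del l (del k L).
Proof. by rewrite /del -!filter_predI; apply: eq_filter => x /=; rewrite andbC. Qed.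

Lemma incrC k l v : incr k (incr l v) = incr l (incr k v).
Proof. by apply/funext => i; rewrite /incr addnAC. Qed.

(* The value on the unit cube at [v], with edges in the directions [L], of the
   simplicial cup product [d f1 \cup ... \cup d fn] modulo 2, for the
   triangulation of the cube by monotone lattice paths. *)
Fixpoint cup (fs : seq (point -> K)) (v : point) (L : seq nat) : K :=
  if fs is a :: fs' then
    \sum_(l <- L) (a (incr l v) + a v) * cup fs' (incr l v) (del l L)
  else 1.

(** The terms at [(k, l)] and [(l, k)] cancel in characteristic 2. *)
Lemma sum_offdiag (L : seq nat) (g : nat -> nat -> K) :
  (forall k l, g k l = g l k) ->
  \sum_(k <- L) \sum_(l <- del k L) g k l = 0.
Proof.
move=> gC; under eq_bigr do rewrite big_filter.
elim: L => [|x L IH]; first by rewrite big_nil.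
rewrite !big_cons eqxx /=.
under [X in _ + X]eq_bigr do rewrite big_cons.
rewrite [X in _ + X](eq_bigr (fun k => (if x != k then g k x else 0) +
   \sum_(l <- L | l != k) g k l)); last first.
  by move=> k _; case: (x != k) => //=; rewrite add0r.
rewrite big_split /= IH addr0 -big_mkcond /=.
rewrite [X in _ + X](eq_big (fun i => i != x) (g x)) ?K2 // => i.
by rewrite eq_sym.
Qed.

Lemma exchange_offdiag (L : seq nat) (g : nat -> nat -> K) :
  \sum_(k <- L) \sum_(l <- del k L) g k l =
  \sum_(l <- L) \sum_(k <- del l L) g k l.
Proof.
under eq_bigr do rewrite big_filter big_mkcond.
rewrite exchange_big /=; apply: eq_bigr => l _.
rewrite big_filter [RHS]big_mkcond /=.
by apply: eq_bigr => k _; rewrite eq_sym.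
Qed.

(* The cup product of coboundaries is a cocycle; all the faces through an
   interior vertex of a path occur twice. *)
Lemma cup_closed (fs : seq (point -> K)) v L :
  \sum_(k <- L) cup fs (incr k v) (del k L) = \sum_(k <- L) cup fs v (del k L).
Proof.
elim: fs v L => [//|a fs IH] v L /=.
(* The terms containing [a (incr l (incr k v))] are symmetric in [k] and [l] and cancel; the
   induction hypothesis then moves the base point of the other factor back to [incr k v]. *)
transitivity (\sum_(k <- L) \sum_(l <- del k L)
    a (incr k v) * cup fs (incr k v) (del l (del k L))).
  transitivity (\sum_(k <- L) \sum_(l <- del k L)
      a (incr k v) * cup fs (incr l (incr k v)) (del l (del k L))).
    under eq_bigr do under eq_bigr do rewrite mulrDl.
    under eq_bigr do rewrite big_split.
    rewrite big_split /= sum_offdiag ?add0r // => k l.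
    by rewrite incrC delC.
  by apply: eq_bigr => k _; rewrite -!mulr_sumr IH.
(* On this side the terms containing [a v] become symmetric by the induction hypothesis; the others
   match after exchanging [k] and [l]. *)
under [RHS]eq_bigr do under eq_bigr do rewrite mulrDl.
under [RHS]eq_bigr do rewrite big_split.
rewrite big_split /= [X in _ = _ + X](_ : _ = 0) ?addr0; last first.
  under eq_bigr do rewrite -mulr_sumr IH.
  under eq_bigr do rewrite mulr_sumr.
  by apply: sum_offdiag => k l; rewrite delC.
rewrite exchange_offdiag; apply: eq_bigr => l _; apply: eq_bigr => k _.
by rewrite delC.
Qed.

(** Leibniz rule: as [cup fs] is closed, the product with the coboundary of [a] is the coboundary of
    [a] times [cup fs]. *)
Lemma cup_split a (fs : seq (point -> K)) v L :
  cup (a :: fs) v L = \sum_(k <- L)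
    (a (incr k v) * cup fs (incr k v) (del k L) + a v * cup fs v (del k L)).
Proof.
rewrite big_split /= -[X in _ = _ + X]mulr_sumr -cup_closed mulr_sumr -big_split.
by apply: eq_bigr => k _; rewrite mulrDl.
Qed.

(** Paths in the directions [L] never change coordinate [k], so [a] is constant along them and its
    coboundary vanishes. *)
Lemma cup_const (a : point -> K) fs v L k (P : set nat) c : k \notin L ->
  P (v k) -> (forall w, P (w k) -> a w = c) ->
  (exists fs1 fs2, fs = fs1 ++ a :: fs2) -> cup fs v L = 0.
Proof.
move=> kL Pv Pa [fs1 [fs2 ->]]; elim: fs1 v L kL Pv => [|b fs1 IH] v L kL Pv /=.
  rewrite big_seq big1 // => l lL; rewrite !Pa ?K2 ?mul0r //.
  rewrite /incr; case: eqP => [kl|_]; last by rewrite addn0.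
  by rewrite kl lL in kL.
rewrite big_seq big1 // => l lL; rewrite IH ?mulr0 //.
  by rewrite mem_filter (negPf kL) andbF.
rewrite /incr; case: eqP => [kl|_]; last by rewrite addn0.
by rewrite kl lL in kL.
Qed.

(** * Sums over a box and Stokes' formula *)

Variable m : nat.

Fixpoint boxsum (L : seq nat) (G : point -> K) : K :=
  if L is k :: L' then \sum_(t < m) boxsum L' (fun v => G (upd v k t))
  else G (fun=> 0%N).

Lemma boxsum_ext L G H : (forall v, (forall k, k \notin L -> v k = 0%N) ->
  (forall k, k \in L -> (v k < m)%N) -> G v = H v) -> boxsum L G = boxsum L H.
Proof.
elim: L G H => [|k L IH] G H GH /=; first exact: GH.
apply: eq_bigr => t _; apply: IH => v v0 vm; apply: GH => l.
  by rewrite inE negb_or /upd => /andP[/negPf -> /v0].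
by rewrite inE /upd; case: eqP => //= _ /vm.
Qed.

Lemma boxsum_sum (J : Type) (r : seq J) L (G : J -> point -> K) :
  boxsum L (fun v => \sum_(j <- r) G j v) = \sum_(j <- r) boxsum L (G j).
Proof.
elim: L G => [//|k L IH] G /=; rewrite exchange_big /=.
by apply: eq_bigr => t _; rewrite IH.
Qed.

Lemma updC v k l s t : k != l -> upd (upd v k s) l t = upd (upd v l t) k s.
Proof.
move=> kl; apply/funext => i; rewrite /upd.
by have [->|//] := eqVneq i l; rewrite eq_sym (negPf kl).
Qed.

Lemma boxsum_del L G k : uniq L -> k \in L ->
  boxsum L G = \sum_(t < m) boxsum (del k L) (fun v => G (upd v k t)).
Proof.
elim: L G => [//|l L IH] G /= /andP[lL uL]; rewrite inE => /predU1P[->|kL].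
  rewrite eqxx /=; apply: eq_bigr => t _; congr boxsum.
  by apply/esym/all_filterP/allP => i iL; apply: contraNneq lL => <-.
have lk : l != k by apply: contraNneq lL => ->.
rewrite lk /=; under eq_bigr do rewrite IH //.
rewrite exchange_big /=; apply: eq_bigr => s _; apply: eq_bigr => t _.
by congr (boxsum _ _); apply/funext => v; rewrite updC // eq_sym.
Qed.

(** Modulo 2 the sum and the difference of consecutive values agree, so only the two faces
    orthogonal to [k] remain. *)
Lemma boxsum_telescope L G k : uniq L -> k \in L ->
  boxsum L (fun v => G (incr k v) + G v) =
  boxsum (del k L) (fun v => G (upd v k m) + G (upd v k 0%N)).
Proof.
move=> uL kL; rewrite (boxsum_del _ uL kL).
rewrite -[LHS](boxsum_sum (index_enum 'I_m) _ (fun t v =>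
  G (incr k (upd v k t)) + G (upd v k t))).
congr (boxsum _ _); apply/funext => v.
rewrite (eq_bigr (fun t : 'I_m => G (upd v k t.+1) + G (upd v k t))); last first.
  move=> t _; congr (G _ + _); apply/funext => i; rewrite /incr /upd.
  by case: eqP => _; rewrite ?addn1 ?addn0.
elim: m => [|p IH]; first by rewrite big_ord0 K2.
rewrite big_ord_recr IH /=.
by rewrite [X in _ + X]addrC addrACA K2 add0r addrC.
Qed.

Lemma map_split (T : Type) (f : nat -> T) (L : seq nat) l : l \in L ->
  exists fs1 fs2, [seq f k | k <- L] = fs1 ++ f l :: fs2.
Proof.
move=> lL; exists [seq f k | k <- take (index l L) L],
  [seq f k | k <- drop (index l L).+1 L].
by rewrite -map_cons -map_cat -drop_index // cat_take_drop.
Qed.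

(* By [cup_split] the sum over the box telescopes in every direction. On the
   two faces orthogonal to [k], the factor [lam k] of the cup product is
   constant; only the faces orthogonal to the first direction survive. *)
Lemma boxsum_cup (L : seq nat) (lam : nat -> point -> K) : uniq L ->
  (forall k v, k \in L -> v k = 0%N -> lam k v = 1) ->
  (forall k v, k \in L -> v k = m -> lam k v = 0) ->
  boxsum L (fun v => cup [seq lam k | k <- L] v L) = 1.
Proof.
elim: L => [//|k L IH] uL lam0 lamm.
have kkL := mem_head k L.
have delk : del k (k :: L) = L.
  rewrite /del /= eqxx /=; apply/all_filterP/allP => i iL.
  by apply: contraTneq uL => <-; rewrite /= iL.
pose G l v := lam k v * cup [seq lam i | i <- L] v (del l (k :: L)).
pose T l := boxsum (del l (k :: L)) (fun v => G l (upd v l m) + G l (upd v l 0%N)).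
transitivity (\sum_(l <- k :: L) T l).
  under eq_fun do rewrite map_cons cup_split.
  rewrite boxsum_sum; apply: eq_big_seq => l lL.
  exact: (@boxsum_telescope _ (G l)).
have kL : k \notin L by case/andP: uL.
rewrite big_cons [X in _ + X]big_seq [X in _ + X]big1 ?addr0 => [|l lL].
  rewrite /T delk -[RHS]IH; last 3 first.
  - by case/andP: uL.
  - by move=> l v lL; apply: lam0; rewrite inE lL orbT.
  - by move=> l v lL; apply: lamm; rewrite inE lL orbT.
  (* Coordinate [k] of [v] is already [0], so the near face is exactly the box of the induction
     hypothesis. *)
  apply: boxsum_ext => v v0 _; rewrite /G delk.
  rewrite (lamm k) ?(lam0 k) ?mul0r ?add0r ?mul1r // /upd ?eqxx //; congr cup.
  by apply/funext => i; case: eqP => // ->; rewrite v0.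
have lD : l \notin del l (k :: L) by rewrite mem_filter eqxx.
have spl := map_split lam lL.
have lkL : l \in k :: L by rewrite inE lL orbT.
rewrite /T (@boxsum_ext _ _ (fun=> 0)) => [|v _ _].
  by elim: (del l _) => [//|j s IHs] /=; rewrite big1.
rewrite /G (cup_const (P := [set m]) (c := 0) lD _ _ spl) /upd /= ?eqxx //; last first.
  by move=> w; apply: lamm.
rewrite (cup_const (P := [set 0%N]) (c := 1) lD _ _ spl) /= ?eqxx //; last first.
  by move=> w; apply: lam0.
by rewrite !mulr0 addr0.
Qed.

Lemma boxsum_neq0 L G : boxsum L G != 0 ->
  exists v, [/\ forall k, k \notin L -> v k = 0%N,
    forall k, k \in L -> (v k < m)%N & G v != 0].
Proof.
move=> GN0; apply: contrapT => nG; case/eqP: GN0.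
rewrite (@boxsum_ext _ _ (fun=> 0)) => [|v v0 vm].
  by elim: L {nG} => [//|j s IHs] /=; rewrite big1.
by apply/eqP; apply: contra_notT nG => Gv; exists v.
Qed.

Definition cube (v : point) (L : seq nat) (w : point) : Prop :=
  forall i, (v i <= w i <= v i + (i \in L))%N.

(** Some path has a nonzero term; its edge belonging to the factor [a] joins two vertices with
    different values. *)
Lemma cup_neq0 fs v L : uniq L -> cup fs v L != 0 -> forall a,
  (exists fs1 fs2, fs = fs1 ++ a :: fs2) ->
  exists w1 w2, [/\ cube v L w1, cube v L w2 & a w1 <> a w2].
Proof.
elim: fs v L => [|b fs IH] v L uL /= nz a [fs1 [fs2 fsE]].
  by case: fs1 fsE.
have [l lL] : exists2 l, l \in L &
    (b (incr l v) + b v) * cup fs (incr l v) (del l L) != 0.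
  apply: contrapT => nl; case/eqP: nz; rewrite big_seq big1 // => l lL.
  by apply/eqP; apply: contra_notT nl => ?; exists l.
have sub w : cube (incr l v) (del l L) w -> cube v L w.
  move=> cw i; have := cw i; rewrite /incr mem_filter.
  by have [->|_] := eqVneq i l; rewrite ?lL /=; lia.
case: fs1 fsE => [|c fs1] [bE fsE] nz'; first rewrite -{a}bE.
  exists (incr l v), v; split.
  - move=> i; rewrite /incr; have [->|_] := eqVneq i l; rewrite ?lL /=; lia.
  - by move=> i; lia.
  - by move=> E; move: nz'; rewrite E K2 mul0r eqxx.
have [||w1 [w2 [c1 c2 ne]]] := IH (incr l v) (del l L) (filter_uniq _ uL) _ a.
  by apply: contraNneq nz' => ->; rewrite mulr0.
  by exists fs1, fs2.
by exists w1, w2; split=> //; apply: sub.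
Qed.

End GridDegree.

(** The total degree is 1 in ['F_2], so some unit cube contributes, and on it every labelling takes
    both values. *)
Lemma grid_cube (n m : nat) (lam : nat -> point -> bool) :
  (forall k v, (k < n)%N -> v k = 0%N -> lam k v) ->
  (forall k v, (k < n)%N -> v k = m -> ~~ lam k v) ->
  exists2 v : point, forall k, (k < n)%N -> (v k < m)%N &
    forall k, (k < n)%N -> exists w1 w2 : point,
      [/\ forall i, (v i <= w1 i <= (v i).+1)%N,
          forall i, (v i <= w2 i <= (v i).+1)%N, lam k w1 & ~~ lam k w2].
Proof.
move=> lam0 lamm.
have K2 (x : 'F_2) : x + x = 0 by case: x => -[|[|[]]] //= ?; apply/val_inj.
pose mu k v : 'F_2 := (lam k v)%:R.
have /eqP : boxsum m (iota 0 n) (fun v => cup [seq mu k | k <- iota 0 n] v (iota 0 n)) = 1.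
  apply: boxsum_cup => // [|k v|k v]; first exact: iota_uniq.
  - by rewrite mem_iota /mu => kn /lam0 ->.
  - by rewrite mem_iota /mu => kn /lamm/negPf ->.
move=> E; have [|v [v0 vm nz]] := @boxsum_neq0 'F_2 m (iota 0 n)
  (fun v => cup [seq mu k | k <- iota 0 n] v (iota 0 n)).
  by rewrite (eqP E).
exists v => k kn; first by apply: vm; rewrite mem_iota.
have kL : k \in iota 0 n by rewrite mem_iota.
have cubeS w : cube v (iota 0 n) w -> forall i, (v i <= w i <= (v i).+1)%N.
  by move=> cw i; have := cw i; lia.
have [w1 [w2 [/cubeS c1 /cubeS c2]]] := cup_neq0 K2 (iota_uniq 0 n) nz (map_split mu kL).
rewrite /mu; case: (boolP (lam k w1)); case: (boolP (lam k w2)) => // n2 l1 _.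
  by exists w1, w2.
by exists w2, w1.
Qed.

(** * Partitions of a cube *)

Section CubePartition.
Variables (R : realType) (n : nat) (lo hi : 'I_n.+1 -> R).
Hypothesis lohi : forall k, lo k < hi k.

Definition box : set 'rV[R]_n.+1 := [set z | forall k, lo k <= z ord0 k <= hi k].

(** Indices are capped at [m.+1], so that every vertex, even one with large coordinates, lands in
    the box. *)
Definition gridpt (m : nat) (v : point) : 'rV[R]_n.+1 :=
  \row_k (lo k + (hi k - lo k) * ((minn (v k) m.+1)%:R / m.+1%:R)).

Lemma gridpt_box m v : box (gridpt m v).
Proof.
move=> k; rewrite mxE; set t := _ / _.
have t0 : 0 <= t by rewrite divr_ge0.
have t1 : t <= 1 by rewrite ler_pdivrMr // mul1r ler_nat geq_minr.
have := lohi k; set a := lo k; set b := hi k => ab.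
by apply/andP; split; nra.
Qed.

Lemma gridpt_lo m (v : point) (k : 'I_n.+1) : v k = 0%N -> gridpt m v ord0 k = lo k.
Proof. by move=> vk; rewrite mxE vk min0n mul0r mulr0 addr0. Qed.

Lemma gridpt_hi m (v : point) (k : 'I_n.+1) : v k = m.+1 -> gridpt m v ord0 k = hi k.
Proof.
move=> vk; rewrite mxE vk minnn divff ?pnatr_eq0 //.
by rewrite mulr1 addrC subrK.
Qed.

Lemma gridpt_dist m (v w : point) : (forall i, (v i <= w i <= (v i).+1)%N) ->
  forall k, `|gridpt m v ord0 k - gridpt m w ord0 k| <=
    (\sum_i (hi i - lo i)) / m.+1%:R.
Proof.
move=> vw k; rewrite !mxE.
have -> : lo k + (hi k - lo k) * ((minn (v k) m.+1)%:R / m.+1%:R) -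
   (lo k + (hi k - lo k) * ((minn (w k) m.+1)%:R / m.+1%:R)) =
   (hi k - lo k) * ((minn (v k) m.+1)%:R - (minn (w k) m.+1)%:R) / m.+1%:R.
  by ring.
have lh : 0 < hi k - lo k by rewrite subr_gt0.
rewrite !normrM (gtr0_norm lh) normfV [`|m.+1%:R|]ger0_norm //.
rewrite ler_pM2r ?invr_gt0 // -[leRHS]mulr1; apply: ler_pM => //; first exact: ltW.
  rewrite (bigD1 k) //= lerDl sumr_ge0 // => i _.
  by rewrite subr_ge0 ltW.
have /andP[v1 w1] := vw k.
rewrite distrC -natrB; last lia.
by rewrite normr_nat lern1; lia.
Qed.

Lemma box_compact : compact box.
Proof.
have := @rV_compact R n.+1 (fun k => `[lo k, hi k]%classic)
  (fun k => @segment_compact _ (lo k) (hi k)).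
congr compact; apply/seteqP; split=> z Hz k; have := Hz k; by rewrite /= in_itv.
Qed.

(* Hurewicz and Wallman: partitions between the pairs of opposite faces of a
   cube have a common point. *)
Lemma cube_partition (U V : 'I_n.+1 -> set 'rV[R]_n.+1) :
  (forall k z, box z -> U k z -> within box (nbhs z) (U k)) ->
  (forall k z, box z -> V k z -> within box (nbhs z) (V k)) ->
  (forall k z, box z -> U k z -> ~ V k z) ->
  (forall k z, box z -> z ord0 k = lo k -> ~ V k z) ->
  (forall k z, box z -> z ord0 k = hi k -> ~ U k z) ->
  exists2 z, box z & forall k, ~ U k z /\ ~ V k z.
Proof.
move=> oU oV UV Vlo Uhi; apply: contrapT => nz.
have {nz} cover z : box z -> exists k, U k z \/ V k z.
  move=> Bz; apply: contrapT => nUV; apply: nz; exists z => // k.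
  by split=> ?; apply: nUV; exists k; [left|right].
(* The second disjunct labels the whole lower face, which [U k] may fail to contain. *)
pose lam m (k : nat) (v : point) : bool :=
  `[< U (inord k) (gridpt m v) \/ v k = 0%N >].
have /choice[v Hv] m : exists v : point, forall k : 'I_n.+1, exists w1 w2 : point,
    [/\ forall i, (v i <= w1 i <= (v i).+1)%N,
        forall i, (v i <= w2 i <= (v i).+1)%N,
        U k (gridpt m w1) \/ w1 k = 0%N & ~ U k (gridpt m w2)].
  have [k v _ vk|k v kn vk|v _ Hv] := @grid_cube n.+1 m.+1 (lam m).
  - by apply/asboolP; right.
  - apply/asboolPn => -[|]; last by rewrite vk.
    apply: Uhi; first exact: gridpt_box.
    by apply: gridpt_hi; rewrite inordK.
  - exists v => k; have [w1 [w2 [c1 c2 l1 l2]]] := Hv k (ltn_ord k).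
    exists w1, w2; split=> //; first by move/asboolP: l1; rewrite inord_val.
    by move/asboolPn: l2; rewrite inord_val => nU ?; apply: nU; left.
(* The base vertices of the chosen cubes accumulate somewhere as the mesh tends to zero. *)
have [z [Bz Cz]] : box `&` cluster ((fun m => gridpt m (v m)) @ \oo) !=set0.
  apply: box_compact; exists 0%N => // m _.
  exact: gridpt_box.
pose M := \sum_i (hi i - lo i).
have M0 : 0 <= M by apply: sumr_ge0 => i _; rewrite subr_ge0 ltW.
(* Arbitrarily near [z] lie entire grid cubes: one half of [e] bounds the distance to the base
   vertex, the other half the mesh. *)
have close e : 0 < e -> exists m, forall w : point,
    (forall i, (v m i <= w i <= (v m i).+1)%N) -> ball z e (gridpt m w).
  move=> e0; pose m0 := Num.bound (M / (e / 2)).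
  have [_ [[m m0m <-] zm]] : [set gridpt m (v m) | m in [set m | (m0 <= m)%N]] `&`
      ball z (e / 2) !=set0.
    apply: Cz; last by apply: nbhsx_ballx; rewrite divr_gt0.
    by exists m0 => // m m0m; exists m.
  exists m => w vw; split=> // i k; have := zm.2 i k; rewrite !ord1 /ball /= => zmk.
  rewrite -(subrKA (gridpt m (v m) ord0 k)) (le_lt_trans (ler_normD _ _)) //.
  rewrite (splitr e) ltr_leD //.
  apply: (le_trans (gridpt_dist m vw k)); rewrite -/M.
  rewrite ler_pdivrMr // mulrC -ler_pdivrMr ?divr_gt0 //.
  have H : M / (e / 2) < m0%:R.
    by apply: archi_boundP; rewrite divr_ge0 // divr_ge0 // ltW.
  by apply: (le_trans (ltW H)); rewrite ler_nat; exact: leqW.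
(* A small cube near [z] lies wholly in [U k] or in [V k]. The first contradicts its vertex outside
   [U k], the second its vertex in [U k] or on the lower face. *)
have [k [Uz|Vz]] := cover z Bz.
- have /nbhs_ballP[e /= e0 He] := oU k z Bz Uz.
  have [m Hm] := close e e0.
  have [w1 [w2 [_ c2 _ nU]]] := Hv m k.
  by apply: nU; apply: He; [exact: Hm|exact: gridpt_box].
- have /nbhs_ballP[e /= e0 He] := oV k z Bz Vz.
  have [m Hm] := close e e0.
  have [w1 [w2 [c1 _ l1 _]]] := Hv m k.
  have V1 : V k (gridpt m w1) by apply: He; [exact: Hm|exact: gridpt_box].
  case: l1 => [/UV|/gridpt_lo E]; first by apply; first exact: gridpt_box.
  by apply: Vlo V1; [exact: gridpt_box|exact: E].
Qed.

End CubePartition.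

(** * Formal disjointness of compact sets *)

(* The complements in [K] of the sets satisfying [Phi] form a filter; it
   would be proper, without a cluster point in [K], if [Phi K] failed. *)
Lemma compact_local (X : topologicalType) (K : set X) (Phi : set X -> Prop) :
  compact K -> Phi set0 ->
  (forall A B, Phi A -> Phi B -> Phi (A `|` B)) ->
  (forall A B, A `<=` B -> Phi B -> Phi A) ->
  (forall x, K x -> exists2 U, nbhs x U & Phi (U `&` K)) -> Phi K.
Proof.
move=> cK Phi0 PhiU PhiS PhiL; apply: contrapT => nPhi.
pose G : set_system X := [set A | Phi (K `\` A)].
have FG : ProperFilter G.
  split=> [|]; first by rewrite /G /= setD0.
  split=> [|A B GA GB|A B AB].
  - by rewrite /G /= setDT.
  - by rewrite /G /= setDIr; apply: PhiU.
  - by apply: PhiS => x [Kx nB]; split=> // /AB.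
have [|x [Kx Cx]] := cK G FG; first by rewrite /G /= setDv.
have [U Ux PhiUK] := PhiL x Kx.
have [|y [nUy Uy]] := Cx (~` U) U _ Ux; last exact: nUy.
by rewrite /G /= setDE setCK setIC.
Qed.

Section FormalSeparation.
Variables (X : topologicalType) (I : nat -> set X) (C D : set (nat * nat)).
Hypotheses (bI : basis (range I)) (rCD : formal_relations I C D).

Definition cover_by (A : set nat) : set X := \bigcup_(i in A) I i.

(** Closing [D] downwards under [formal_le] gives a c.e. form of disjointness that is inherited by
    formal refinements. *)
Definition formal_apart (a b : nat) : Prop := exists a' b',
  [/\ formal_le C a a', formal_le C b b' & D (a', b')].

Lemma basic_open i : open (I i).
Proof. by case: bI => + _; apply; exists i. Qed.

Lemma basic_nbhs i x : I i x -> nbhs x (I i).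
Proof. by move=> ix; apply: open_nbhs_nbhs; split=> //; exact: basic_open. Qed.

Lemma basic_inside (U : set X) x : nbhs x U -> exists2 i, I i x & I i `<=` U.
Proof.
case: bI => _ /(_ x) H /H [_ [[i _ <-] Ix] IU].
by exists i.
Qed.

Lemma formal_le_trans b a c :
  formal_le C a b -> formal_le C b c -> formal_le C a c.
Proof.
by elim=> {a b}[//|a a' b Caa' _ IH] /IH; apply: rt1n_trans.
Qed.

Lemma formal_le_subset a b : formal_le C a b -> I a `<=` I b.
Proof.
elim=> {a b}[a x //|a a' b Caa' _ IH]; apply: subset_trans IH.
exact: (formal_subset rCD).
Qed.

Lemma formal_le_refine a b x : I a x -> I b x ->
  exists c, [/\ I c x, formal_le C c a & formal_le C c b].
Proof.
move=> ax bx; have [|c [cx ca cb]] := @formal_refinement _ _ _ _ rCD x a b.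
  by [].
by exists c; split=> //; apply: rt1n_trans (rt1n_refl _ _ _).
Qed.

Lemma formal_apart_disjoint a b x : formal_apart a b -> I a x -> ~ I b x.
Proof.
move=> [a' [b' [/formal_le_subset aa' /formal_le_subset bb' Dab]]] /aa' ? /bb' ?.
have : (I a' `&` I b') x by [].
by rewrite (formal_disjoint rCD Dab).
Qed.

Lemma formal_apart_le a b a' b' : formal_le C a a' -> formal_le C b b' ->
  formal_apart a' b' -> formal_apart a b.
Proof.
move=> aa' bb' [a'' [b'' [aa'' bb'' Dab]]]; exists a'', b''.
by split=> //; [apply: formal_le_trans aa''|apply: formal_le_trans bb''].
Qed.

Lemma formal_hausdorff : hausdorff_space X.
Proof.
rewrite open_hausdorff => x y /eqP xy.
have [i [j [ix jy Dij]]] := formal_separation rCD xy.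
exists (I i, I j); first by rewrite !inE.
split; [exact: basic_open|exact: basic_open|].
exact/eqP/(formal_disjoint rCD Dij).
Qed.

Lemma cover_byU A B : cover_by (A `|` B) = cover_by A `|` cover_by B.
Proof. exact: bigcup_setU. Qed.

Lemma cover_by1 a : cover_by [set a] = I a.
Proof. exact: bigcup_set1. Qed.

Lemma compact_basic_cover (K : set X) (P : nat -> Prop) : compact K ->
  (forall x, K x -> exists2 i, I i x & P i) ->
  exists A, [/\ finite_set A, A `<=` P & K `<=` cover_by A].
Proof.
move=> cK KP; apply: (compact_local (Phi := fun M =>
  exists A, [/\ finite_set A, A `<=` P & M `<=` cover_by A]) cK).
- by exists set0; split; [exact: finite_set0|exact: sub0set|exact: sub0set].
- move=> M N [A [fA AP MA]] [B [fB BP NB]]; exists (A `|` B); split.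
  + by rewrite finite_setU.
  + by rewrite subUset.
  + by rewrite cover_byU; apply: setUSS.
- by move=> M N MN [A [fA AP NA]]; exists A; split=> //; apply: subset_trans NA.
- move=> x /KP[i ix Pi]; exists (I i); first exact: basic_nbhs.
  exists [set i]; split; [exact: finite_set1|by move=> _ ->|].
  by rewrite cover_by1; apply: subIsetl.
Qed.

Lemma compact_open_cover (K U : set X) : compact K -> open U -> K `<=` U ->
  exists A, [/\ finite_set A, K `<=` cover_by A & cover_by A `<=` U].
Proof.
move=> cK oU KU; have [|A [fA AU KA]] := @compact_basic_cover K (fun i => I i `<=` U) cK.
  by move=> x /KU Ux; apply: basic_inside; apply: open_nbhs_nbhs.
by exists A; split=> //; apply: bigcup_sub.
Qed.

(** Compactness is used twice, as for separating compact sets in a Hausdorff space; [P] and [Q] are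
    closed downwards so that they survive the refinements. *)
Lemma compact_formal_apart (K L : set X) (P Q : nat -> Prop) :
  compact K -> compact L -> K `&` L = set0 ->
  (forall a b, formal_le C a b -> P b -> P a) ->
  (forall a b, formal_le C a b -> Q b -> Q a) ->
  (forall x, K x -> exists2 i, I i x & P i) ->
  (forall x, L x -> exists2 i, I i x & Q i) ->
  exists A B, [/\ finite_set A, finite_set B, A `<=` P & B `<=` Q] /\
    [/\ K `<=` cover_by A, L `<=` cover_by B &
      forall a b, A a -> B b -> formal_apart a b].
Proof.
move=> cK cL KL dP dQ KP LQ.
(* First one point against [L]: joining two pieces of [L] means refining two basic neighborhoods of
   [x] to a common one. *)
have step1 x : K x -> exists a B, [/\ I a x, P a, finite_set B & B `<=` Q] /\
    L `<=` cover_by B /\ forall b, B b -> formal_apart a b.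
  move=> Kx; apply: (compact_local (Phi := fun M => exists a B,
      [/\ I a x, P a, finite_set B & B `<=` Q] /\
      M `<=` cover_by B /\ forall b, B b -> formal_apart a b) cL).
  - have [a ax Pa] := KP x Kx; exists a, set0; split; last by split=> // ? [].
    by split=> //; exact: sub0set.
  - move=> M N [a [A [[ax Pa fA AQ] [MA aA]]]] [b [B [[bx Pb fB BQ] [NB bB]]]].
    have [c [cx ca cb]] := formal_le_refine ax bx.
    exists c, (A `|` B); split; first split=> //.
    + exact: dP Pa.
    + by rewrite finite_setU.
    + by rewrite subUset.
    split; first by rewrite cover_byU; apply: setUSS.
    move=> d [/aA|/bB]; apply: formal_apart_le => //; exact: rt1n_refl.
  - move=> M N MN [a [B [HB [NB aB]]]]; exists a, B; split=> //; split=> //.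
    exact: subset_trans NB.
  - move=> y Ly; have [i ix Pi] := KP x Kx; have [j jy Qj] := LQ y Ly.
    have /(formal_separation rCD)[a [b [ax bY Dab]]] : x <> y.
      move=> xy; have : (K `&` L) x by split=> //; rewrite xy.
      by rewrite KL.
    have [a' [a'x a'i a'a]] := formal_le_refine ix ax.
    have [b' [b'y b'j b'b]] := formal_le_refine jy bY.
    exists (I b'); first exact: basic_nbhs.
    exists a', [set b']; split; first split=> //.
    + exact: dP Pi.
    + by move=> _ ->; apply: dQ Qj.
    split; first by rewrite cover_by1; apply: subIsetl.
    by move=> _ ->; exists a, b.
apply: (compact_local (Phi := fun M => exists A B,
  [/\ finite_set A, finite_set B, A `<=` P & B `<=` Q] /\
  [/\ M `<=` cover_by A, L `<=` cover_by B &
      forall a b, A a -> B b -> formal_apart a b]) cK).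
- have [B [fB BQ LB]] := compact_basic_cover cL LQ.
  by exists set0, B; split; split=> //; exact: sub0set.
- move=> M N [A1 [B1 [[fA1 fB1 PA1 QB1] [MA1 LB1 AB1]]]].
  move=> [A2 [B2 [[fA2 fB2 PA2 QB2] [NA2 LB2 AB2]]]].
  (* Joining two pieces of [K] requires one cover of [L] that refines both given covers. *)
  have [|B [fB BB LB]] := @compact_basic_cover L (fun b =>
      (exists2 b1, B1 b1 & formal_le C b b1) /\
      (exists2 b2, B2 b2 & formal_le C b b2)) cL.
    move=> y Ly; have [b1 Bb1 b1y] := LB1 y Ly; have [b2 Bb2 b2y] := LB2 y Ly.
    have [b [bY bb1 bb2]] := formal_le_refine b1y b2y.
    by exists b => //; split; [exists b1|exists b2].
  exists (A1 `|` A2), B; split; split=> //.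
  + by rewrite finite_setU.
  + by rewrite subUset.
  + by move=> b /BB[[b1 /QB1 Qb1 bb1] _]; apply: dQ Qb1.
  + by rewrite cover_byU; apply: setUSS.
  + move=> a b Aa /BB[[b1 B1b bb1] [b2 B2b bb2]].
    case: Aa => [A1a|A2a].
      by apply: formal_apart_le bb1 (AB1 _ _ A1a B1b); exact: rt1n_refl.
    by apply: formal_apart_le bb2 (AB2 _ _ A2a B2b); exact: rt1n_refl.
- move=> M N MN [A [B [HAB [NA LB AB]]]]; exists A, B; split=> //; split=> //.
  exact: subset_trans NA.
- move=> x /step1[a [B [[ax Pa fB BQ] [LB aB]]]].
  exists (I a); first exact: basic_nbhs.
  exists [set a], B; split; split=> //.
  + by move=> _ ->.
  + by rewrite cover_by1; apply: subIsetl.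
  + by move=> _ b ->; apply: aB.
Qed.

End FormalSeparation.

(** * Half-space charts *)

Section Chart.
Variables (R : realType) (n : nat) (X : topologicalType) (S N : set X).
Variables (f : 'rV[R]_n.+1 -> X) (p : 'rV[R]_n.+1).
Hypotheses (hN : neighborhood_in S (f p) N)
  (hf : homeomorphism_on (halfspace R n) N f) (hp : bd_halfspace R n p).

(** The closed half cube at [p]: its last coordinate starts at the boundary value [0], which is also
    the last coordinate of [p]. *)
Definition hbox (r : R) : set 'rV[R]_n.+1 :=
  box (fun k => if k == ord_max then 0 else p ord0 k - r)
      (fun k => p ord0 k + r).

Definition hball (r : R) : set 'rV[R]_n.+1 := halfspace R n `&` ball p r.

Lemma hbox_halfspace r : hbox r `<=` halfspace R n.
Proof. by move=> z /(_ ord_max); rewrite eqxx => /andP[]. Qed.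

Lemma hball_hbox r : hball r `<=` hbox r.
Proof.
move=> z [Hz [_ /(_ ord0)]] + k => /(_ k); rewrite /ball /= ltr_norml => /andP[].
have := Hz; rewrite /halfspace /=; case: eqP => [->|_] Hk; lra.
Qed.

Lemma hbox_hball r s : 0 < s -> r < s -> hbox r `<=` hball s.
Proof.
move=> s0 rs z Bz; split; first exact: hbox_halfspace Bz.
split=> // i k; rewrite ord1 /ball /= ltr_norml.
have := Bz k; case: eqP => [->|_] /andP[]; last lra.
by move: hp; rewrite /bd_halfspace /= => ->; lra.
Qed.

(** The truncated box is again a box, possibly empty, with one upper bound lowered. *)
Lemma box_le_compact (lo hi : 'I_n.+1 -> R) k c :
  compact (box lo hi `&` [set y | y ord0 k <= c]).
Proof.
have := @box_compact R n lo (fun i => if i == k then Num.min c (hi i) else hi i).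
congr compact; apply/seteqP; split=> [z Bz|z [Bz zk] i].
  split=> [i|]; have := Bz k; last by rewrite /= eqxx le_min => /and3P[].
  by have := Bz i; case: eqP => // ->; rewrite le_min => /and3P[-> _ ->].
by have := Bz i; case: eqP => // ->; rewrite le_min => /andP[-> ->]; rewrite zk.
Qed.

Lemma box_ge_compact (lo hi : 'I_n.+1 -> R) k c :
  compact (box lo hi `&` [set y | c <= y ord0 k]).
Proof.
have := @box_compact R n (fun i => if i == k then Num.max c (lo i) else lo i) hi.
congr compact; apply/seteqP; split=> [z Bz|z [Bz zk] i].
  split=> [i|]; have := Bz k; last by rewrite /= eqxx ge_max -andbA => /and3P[].
  by have := Bz i; case: eqP => // ->; rewrite ge_max -andbA => /and3P[_ -> ->].
by have := Bz i; case: eqP => // ->; rewrite ge_max => /andP[-> ->]; rewrite zk.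
Qed.

Lemma chart_sub y : halfspace R n y -> S (f y).
Proof.
case: hf => -[fN _ _] _ Hy; case: hN => _ NS _; apply: NS.
by apply: fN.
Qed.

Lemma chart_inj y z : halfspace R n y -> halfspace R n z -> f y = f z -> y = z.
Proof.
by case: hf => _ [_ [g gK _]] Hy Hz fyz; rewrite -(gK y) // -(gK z) // fyz.
Qed.

Lemma chart_compact A : A `<=` halfspace R n -> compact A -> compact (f @` A).
Proof.
case: hf => _ [cf _] AH; apply: continuous_compact.
exact: continuous_subspaceW cf.
Qed.

Lemma chart_disjoint A B : A `<=` halfspace R n -> B `<=` halfspace R n ->
  A `&` B = set0 -> f @` A `&` f @` B = set0.
Proof.
move=> AH BH AB; apply/seteqP; split=> // _ [[y Ay <-] [z Bz]].
move/(chart_inj (BH _ Bz) (AH _ Ay)) => zy.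
have : (A `&` B) y by split; rewrite // -zy.
by rewrite AB.
Qed.

Lemma chart_continuous y (U : set X) : halfspace R n y -> nbhs (f y) U ->
  within (halfspace R n) (nbhs y) (fun z => U (f z)).
Proof.
case: hf => _ [/subspace_continuousP cf _] Hy Uy.
exact: (cf y Hy U Uy).
Qed.

(** For small [r] the half ball is mapped into an open set whose trace on [S] lies in [N]; there the
    inverse chart is continuous, so images of half balls are open in [S]. *)
Lemma chart_open : exists2 r, 0 < r & forall s, s <= r ->
  forall u, (f @` hball s) u -> nbhs u [set u' | S u' -> (f @` hball s) u'].
Proof.
case: hN => _ NS; rewrite /within /= nbhsE => -[V [oV Vp] VN].
have Hp : halfspace R n p by rewrite /halfspace /= hp.
have /nbhs_ballP[r /= r0 Hr] := chart_continuous Hp (open_nbhs_nbhs (conj oV Vp)).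
exists r => // s sr _ [y [Hy py] <-].
have Vy : V (f y) by apply: Hr => //; apply: le_ball py.
case: hf => -[_ _ fsurj] [_ [g gK /subspace_continuousP cg]].
have Ny : N (f y) by case: hf => -[fN _ _] _; apply: fN.
have By : nbhs (g (f y)) (ball p s).
  rewrite gK //; apply: open_nbhs_nbhs; split=> //.
  exact: ball_open.
have Gy : nbhs (f y) [set u | N u -> ball p s (g u)] := cg _ Ny _ By.
apply: filterS2 Gy (open_nbhs_nbhs (conj oV Vy)) => u /= pu Vu Su.
have Nu : N u by exact: VN.
have [z Hz zu] := fsurj u Nu.
exists z => //; split=> //; rewrite -[z]gK // zu.
exact: pu.
Qed.

Lemma chart_perturb (U : set X) (s : R) y : open U -> hball s y -> U (f y) ->
  exists (q : 'rV[R]_n.+1) (d : R), [/\ 0 < d, d < q ord0 ord_max, ball p s q &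
    forall z, halfspace R n z -> (forall k, `|z ord0 k - q ord0 k| < d) -> U (f z)].
Proof.
move=> oU [Hy py] Uy.
have nU : nbhs y [set z | halfspace R n z -> U (f z)].
  exact: chart_continuous Hy (open_nbhs_nbhs (conj oU Uy)).
have nB : nbhs y (ball p s).
  by apply: open_nbhs_nbhs; split=> //; apply: ball_open.
have /nbhs_ballP[e /= e0 He] :
    nbhs y ([set z | halfspace R n z -> U (f z)] `&` ball p s) by exact: filterI.
(* Raising the last coordinate by [e / 2] moves [y] off the boundary; the cube of radius [e / 4]
   around [q] stays off it and within distance [e] of [y]. *)
pose q : 'rV[R]_n.+1 := \row_k (y ord0 k + (if k == ord_max then e / 2 else 0)).
have Hy' := Hy; rewrite /halfspace /= in Hy'.
exists q, (e / 4); split; first lra.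
- by rewrite mxE eqxx; lra.
- have /He[_ //] : ball y e q.
  split=> // i k; rewrite ord1 /ball /= mxE ltr_norml.
  by case: ifP => _; lra.
- move=> z Hz zq; have /He[Uz _] : ball y e z; last exact: Uz.
  split=> // i k; rewrite ord1 /ball /= ltr_norml.
  have := zq k; rewrite mxE ltr_norml.
  by case: ifP => _; lra.
Qed.

End Chart.

(** * Certificates *)

Ltac computability :=
  repeat lazymatch goal with
  | |- computable_fun (fun n => nfst (@?f n)) => apply: (@computable_nfst f)
  | |- computable_fun (fun n => nsnd (@?f n)) => apply: (@computable_nsnd f)
  | |- computable_fun (fun n => nentry ?k (@?f n)) => apply: (@computable_nentry k f)
  | |- computable_fun nfst => exact: (computable_nfst computable_id)
  | |- computable_fun nsnd => exact: (computable_nsnd computable_id)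
  | |- computable_fun (fun n => n) => exact: computable_id
  | |- computable_fun (fun _ => ?c) => exact: (computable_const c)
  end.

Section Certificate.
Variables (F : nat -> set nat) (hF : finite_sets_enum F).
Variables (X : topologicalType) (I : nat -> set X) (C D : set (nat * nat)).
Hypotheses (bI : basis (range I)) (rCD : formal_relations I C D).
Variables (S T : set X) (hS : semicomputable I F S) (hT : semicomputable I F T).
Variables (n w : nat) (gm gp : 'I_n.+1 -> nat).

Let fin := finset_of F.

Lemma sigma1_formal_apart : sigma1_rel (formal_apart C D).
Proof.
apply: (@sigma1_ext (fun z => exists a' b', formal_le C (nfst z) a' /\
  formal_le C (nsnd z) b' /\ D (a', b'))).
  move=> z; split=> [[a' [b' [? [? ?]]]]|[a' [b' [? ? ?]]]]; by exists a', b'.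
have sC := sigma1_formal_le (ce_C rCD); have sD := ce_set2_sigma1 (ce_D rCD).
do 2![apply: sigma1_exists]; do ![apply: sigma1_and].
- by apply: (sigma1_rel_comp sC); computability.
- by apply: (sigma1_rel_comp sC); computability.
- by apply: (sigma1_rel_comp sD); computability.
Qed.

(* The finite unions coded by [u k] and [v k] are formally disjoint and avoid,
   through the fixed covers [gm k] and [gp k], the upper and lower [k]-th faces
   of a fixed cube, except that the lower face in the last direction is only
   controlled through the cover of [T]. Together with [I i] and the fixed
   cover [w] of the outside of the cube they cover [S]. *)
Definition certificate (i j t : nat) (u v : 'I_n.+1 -> nat) : Prop :=
  S `<=` cover_by I (F j) /\ T `<=` cover_by I (F t) /\
  (forall k a, fin (u k) a -> (forall b, fin (v k) b -> formal_apart C D a b) /\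
     exists c, fin (gm k) c /\ formal_le C a c) /\
  (forall k b, fin (v k) b -> exists c, fin (gp k) c /\ formal_le C b c) /\
  (forall c, fin j.+1 c ->
     c = i \/ fin w c \/ exists k, fin (u k) c \/ fin (v k) c) /\
  (forall c, fin t.+1 c -> fin w c \/ fin (u ord_max) c).

Definition certified (i : nat) : Prop := exists z,
  certificate i (nfst z) (nfst (nsnd z))
    (fun k => nentry k (nfst (nsnd (nsnd z))))
    (fun k => nentry k (nsnd (nsnd (nsnd z)))).

Lemma certifiedP i : certified i <-> exists j t u v, certificate i j t u v.
Proof.
split=> [[z cz]|[j [t [u [v c]]]]]; first by do 4!eexists; exact: cz.
have [s1 Hs1] := nentry_surj n.+1 (fun k => u (inord k)).
have [s2 Hs2] := nentry_surj n.+1 (fun k => v (inord k)).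
exists (npair j (npair t (npair s1 s2))); rewrite !(npairK1, npairK2).
have -> : (fun k : 'I_n.+1 => nentry k s1) = u.
  by apply/funext => k; rewrite Hs1 // inord_val.
suff -> : (fun k : 'I_n.+1 => nentry k s2) = v by [].
by apply/funext => k; rewrite Hs2 // inord_val.
Qed.

(** Semicomputability makes the two covering clauses c.e.; the others are c.e. formal relations
    quantified over finite sets. *)
Lemma sigma1_certified : sigma1 certified.
Proof.
have sC := sigma1_formal_le (ce_C rCD); have sA := sigma1_formal_apart.
have sS : sigma1 (fun j => S `<=` cover_by I (F j)).
  by case: hS => _ /ce_set_sigma1.
have sT : sigma1 (fun j => T `<=` cover_by I (F j)).
  by case: hT => _ /ce_set_sigma1.
rewrite /certified /certificate.
apply: sigma1_exists; do ![apply: sigma1_and]; try apply: sigma1_all => k.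
- by apply: (sigma1_comp sS); computability.
- by apply: (sigma1_comp sT); computability.
- apply: (sigma1_forall_finset_of hF); first by computability.
  apply: sigma1_and.
    apply: (sigma1_forall_finset_of hF); first by computability.
    by apply: (sigma1_rel_comp sA); computability.
  apply: sigma1_exists; apply: sigma1_and.
    by apply: (sigma1_finset_of hF); computability.
  by apply: (sigma1_rel_comp sC); computability.
- apply: (sigma1_forall_finset_of hF); first by computability.
  apply: sigma1_exists; apply: sigma1_and.
    by apply: (sigma1_finset_of hF); computability.
  by apply: (sigma1_rel_comp sC); computability.
- apply: (sigma1_forall_finset_of hF).
    by apply: (computable_addn (computable_const 1)); computability.
  apply: sigma1_or; first by apply: sigma1_eq; computability.
  apply: sigma1_or; first by apply: (sigma1_finset_of hF); computability.
  by apply: sigma1_has => k; apply: sigma1_or; apply: (sigma1_finset_of hF); computability.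
- apply: (sigma1_forall_finset_of hF).
    by apply: (computable_addn (computable_const 1)); computability.
  by apply: sigma1_or; apply: (sigma1_finset_of hF); computability.
Qed.

Variables (R : realType) (N : set X) (f : 'rV[R]_n.+1 -> X) (p : 'rV[R]_n.+1) (r : R).
Hypotheses (hN : neighborhood_in S (f p) N)
  (hf : homeomorphism_on (halfspace R n) N f) (hp : bd_halfspace R n p)
  (fT : f @` bd_halfspace R n = N `&` T) (TS : T `<=` S) (r0 : 0 < r).
Hypotheses (w_cover : S `\` f @` hball p r `<=` cover_by I (fin w))
  (w_avoid : forall y, hbox p (r / 2) y -> ~ cover_by I (fin w) (f y))
  (gm_cover : forall k y, hbox p r y -> y ord0 k <= p ord0 k + r / 4 ->
     cover_by I (fin (gm k)) (f y))
  (gm_avoid : forall k y, hbox p (r / 2) y -> p ord0 k + r / 2 <= y ord0 k ->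
     ~ cover_by I (fin (gm k)) (f y))
  (gp_cover : forall k y, hbox p r y -> p ord0 k - r / 4 <= y ord0 k ->
     cover_by I (fin (gp k)) (f y))
  (gp_avoid : forall k y, hbox p (r / 2) y -> y ord0 k <= p ord0 k - r / 2 ->
     ~ cover_by I (fin (gp k)) (f y)).

Lemma certificate_sound i j t u v :
  certificate i j t u v -> I i `&` S !=set0.
Proof.
have r_gt0 := r0; move=> [Sj [Tt [uv [vgp [jc tc]]]]].
apply: contrapT => /set0P/negP; rewrite negbK => /eqP IS0.
pose B := hbox p (r / 2).
have BH : B `<=` halfspace R n by exact: hbox_halfspace.
pose U k : set 'rV[R]_n.+1 := [set y | cover_by I (fin (u k)) (f y)].
pose V k : set 'rV[R]_n.+1 := [set y | cover_by I (fin (v k)) (f y)].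
have oUV (c : 'I_n.+1 -> nat) k z : B z -> cover_by I (fin (c k)) (f z) ->
    within B (nbhs z) [set y | cover_by I (fin (c k)) (f y)].
  move=> Bz Cz.
  have nz : nbhs (f z) (cover_by I (fin (c k))).
    apply: open_nbhs_nbhs; split=> //; apply: bigcup_open => a _.
    exact: basic_open.
  have := chart_continuous hf (BH _ Bz) nz; rewrite /within /=.
  by apply: filterS => y Hy /BH.
have UV k z : B z -> U k z -> ~ V k z.
  move=> _ [a ua az] [b vb bz]; have [/(_ b vb) ab _] := uv k a ua.
  exact: (formal_apart_disjoint rCD ab az bz).
have lohi k : (if k == ord_max then 0 else p ord0 k - r / 2) < p ord0 k + r / 2.
  by case: eqP => [->|_]; last lra; move: hp; rewrite /bd_halfspace /= => ->; lra.
(* A point of the bottom face lies in [T], so it is covered by [w] or [u ord_max]. As [w] avoids the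
   half cube, it is in [U ord_max], hence not in [V ord_max]. *)
have Vlo k z : B z -> z ord0 k = (if k == ord_max then 0 else p ord0 k - r / 2) ->
    ~ V k z.
  move=> Bz; case: eqP => [-> z0|_ zk].
    have [c tc' cz] : cover_by I (F t) (f z).
      apply: Tt; have : (f @` bd_halfspace R n) (f z) by exists z.
      by rewrite fT => -[].
    have [wc|uc] := tc c tc'; first by case: (w_avoid Bz); exists c.
    by apply: UV => //; exists c.
  move=> [b vb bz]; have [c [gc bc]] := vgp k b vb.
  apply: (@gp_avoid k z Bz); first by rewrite zk.
  by exists c => //; apply: (formal_le_subset rCD bc).
have Uhi k z : B z -> z ord0 k = p ord0 k + r / 2 -> ~ U k z.
  move=> Bz zk [a ua az]; have [_ [c [gc ac]]] := uv k a ua.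
  apply: (@gm_avoid k z Bz); first by rewrite zk.
  by exists c => //; apply: (formal_le_subset rCD ac).
(* The common point of the partitions lies in [S], but none of the covering sets can contain it. *)
have [z Bz Hz] := cube_partition lohi (oUV u) (oUV v) UV Vlo Uhi.
have Sz : S (f z) by apply: (chart_sub hN hf); apply: BH.
have [c jc' cz] := Sj _ Sz.
have [ci|[wc|[k [uc|vc]]]] := jc c jc'.
- have : (I i `&` S) (f z) by split=> //; rewrite -ci.
  by rewrite IS0.
- by apply: (w_avoid Bz); exists c.
- by apply: (Hz k).1; exists c.
- by apply: (Hz k).2; exists c.
Qed.

Lemma certificate_complete i : I i `&` f @` hball p (r / 4) !=set0 ->
  exists j t u v, certificate i j t u v.
Proof.
have r_gt0 := r0; move=> [s0 [is0 [y hy yE]]].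
have iy : I i (f y) by rewrite yE.
have [q [d [d0 dq [_ pq] Hq]]] := chart_perturb hf (basic_open bI i) hy iy.
(* This puts the parts of the cube below and above [q] within the regions covered through [gm] and
   [gp]. *)
have {}pq k : p ord0 k - r / 4 < q ord0 k < p ord0 k + r / 4.
  by have := pq ord0 k; rewrite /ball /= ltr_norml => /andP[? ?]; apply/andP; split; lra.
pose Km k := hbox p r `&` [set y | y ord0 k <= q ord0 k - d].
pose Kp k := hbox p r `&` [set y | q ord0 k + d <= y ord0 k].
have boxH : hbox p r `<=` halfspace R n by exact: hbox_halfspace.
have KmH k : Km k `<=` halfspace R n by move=> z [/boxH].
have KpH k : Kp k `<=` halfspace R n by move=> z [/boxH].
have below (g : nat) a b : formal_le C a b ->
    (exists c, fin g c /\ formal_le C b c) -> exists c, fin g c /\ formal_le C a c.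
  by move=> ab [c [gc bc]]; exists c; split=> //; apply: formal_le_trans bc.
have /choice[uv Huv] k : exists uv : nat * nat,
    [/\ forall a, fin uv.1 a -> (forall b, fin uv.2 b -> formal_apart C D a b) /\
          exists c, fin (gm k) c /\ formal_le C a c,
        forall b, fin uv.2 b -> exists c, fin (gp k) c /\ formal_le C b c,
        f @` Km k `<=` cover_by I (fin uv.1) &
        f @` Kp k `<=` cover_by I (fin uv.2)].
  have [|||||||A [B [[fA fB AP BQ] [KA KB AB]]]] := @compact_formal_apart X I C D bI rCD
    (f @` Km k) (f @` Kp k) (fun a => exists c, fin (gm k) c /\ formal_le C a c)
    (fun b => exists c, fin (gp k) c /\ formal_le C b c).
  - exact/(chart_compact hf (KmH k))/box_le_compact.
  - exact/(chart_compact hf (KpH k))/box_ge_compact.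
  - apply: (chart_disjoint hf (KmH k) (KpH k)).
    by apply/seteqP; split=> // z [[_ /= z1] [_ /= z2]]; lra.
  - exact: below.
  - exact: below.
  - move=> _ [z [Bz /= zk] <-]; have /andP[_ ?] := pq k.
    have [|c gc cz] := @gm_cover k z Bz; first lra.
    by exists c => //; exists c; split=> //; exact: rt1n_refl.
  - move=> _ [z [Bz /= zk] <-]; have /andP[? _] := pq k.
    have [|c gc cz] := @gp_cover k z Bz; first lra.
    by exists c => //; exists c; split=> //; exact: rt1n_refl.
  have [u uA] := finset_of_surj hF fA; have [v vB] := finset_of_surj hF fB.
  exists (u, v); rewrite /fin /= uA vB; split=> // a Aa.
  by split=> [b|]; [exact: AB|exact: AP].
pose E := [set i] `|` fin w `|` \bigcup_(k in [set: 'I_n.+1]) (fin (uv k).1 `|` fin (uv k).2).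
have finE a : finite_set (fin a) by exact: finite_finset_of.
have fE : finite_set E.
  rewrite !finite_setU; do ![split=> //].
  by apply: bigcup_finite => // k _; rewrite finite_setU.
have SE : S `<=` cover_by I E.
  (* Off the half ball [w] covers; within distance [d] of [q] in all coordinates [I i] does;
     otherwise some coordinate puts the point in [Kp k] or [Km k]. *)
  move=> s Ss; have [[z hz zs]|ns] := pselect ((f @` hball p r) s); last first.
    by have [c wc cs] := w_cover (conj Ss ns); exists c => //; left; right.
  have Bz := hball_hbox hz.
  have [near|] := pselect (forall k, `|z ord0 k - q ord0 k| < d).
    exists i; first by left; left.
    by rewrite -zs; apply: Hq => //; exact: boxH.
  move=> /existsNP[k /negP]; rewrite -leNgt ler_normr => zk.
  have [_ _ KmC KpC] := Huv k.
  case/orP: zk => zk.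
    have [|c vc cs] := KpC s; first by exists z => //; split=> //=; lra.
    by exists c => //; right; exists k => //; right.
  have [|c uc cs] := KmC s; first by exists z => //; split=> //=; lra.
  by exists c => //; right; exists k => //; left.
(* Inside the half ball a point of [T] has last coordinate [0], which is below [q ord0 ord_max - d];
   so it lies in the image of [Km ord_max]. *)
have TE : T `<=` cover_by I (fin w `|` fin (uv ord_max).1).
  move=> s Ts; have Ss := TS Ts.
  have [[z hz zs]|ns] := pselect ((f @` hball p r) s); last first.
    by have [c wc cs] := w_cover (conj Ss ns); exists c => //; left.
  have Bz := hball_hbox hz.
  have [_ _ KmC _] := Huv ord_max.
  have [|c uc cs] := KmC s; last by exists c => //; right.
  exists z => //; split=> //=.
  have Nz : N s by rewrite -zs; case: hf => -[fN _ _] _; apply: fN; case: hz.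
  have [z' Bz' z's] : (f @` bd_halfspace R n) s by rewrite fT.
  have <- : z' = z.
    apply: (chart_inj hf); [|by case: hz|by rewrite z's zs].
    by rewrite /halfspace /= Bz'.
  by rewrite Bz'; lra.
have [j jE] : exists j, F j = E.
  by apply: (finite_enum_surj hF) => //; exists i; left; left.
have [t tE] : exists t, F t = fin w `|` fin (uv ord_max).1.
  apply: (finite_enum_surj hF); first by rewrite finite_setU.
  (* [F] enumerates nonempty sets only; the cover of [T] is nonempty because [T] contains [f p]. *)
  have : T (f p) by have : (f @` bd_halfspace R n) (f p) by [exists p]; rewrite fT => -[].
  by move=> /TE[c Ec _]; exists c.
exists j, t, (fun k => (uv k).1), (fun k => (uv k).2); split; first by rewrite jE.
split; first by rewrite tE.
split; first by move=> k; case: (Huv k).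
split; first by move=> k; case: (Huv k).
split=> c; rewrite /fin /=.
  rewrite jE => -[[->|wc]|[k _ uvk]]; [by left|by right; left|].
  by right; right; exists k.
by rewrite tE.
Qed.

End Certificate.

(** * Choice of the fixed covers and conclusion *)

(** The space is Hausdorff, so the complement of [L] is open and [K] is covered by finitely many
    basic sets inside it. *)
Lemma compact_code_avoid (F : nat -> set nat) (hF : finite_sets_enum F)
    (X : topologicalType) (I : nat -> set X) (hX : computable_topological_space I)
    (K L : set X) : compact K -> compact L -> K `&` L = set0 ->
  exists u, K `<=` cover_by I (finset_of F u) /\
    forall y, L y -> ~ cover_by I (finset_of F u) y.
Proof.
case: hX => bI [C [D rCD]] cK cL KL0.
have [||A [fA KA AL]] := @compact_open_cover _ _ bI K (~` L) cK.
- exact: closed_openC (compact_closed (formal_hausdorff bI rCD) cL).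
- exact/disjoints_subset.
have [u uA] := finset_of_surj hF fA.
by exists u; rewrite uA; split=> // y Ly /AL.
Qed.

Theorem theorem7p2 (R : realType) (F : nat -> set nat)
    (hF : finite_sets_enum F)
    (X : topologicalType) (I : nat -> set X)
    (hX : computable_topological_space I)
    (S T : set X) (hS : semicomputable I F S) (hT : semicomputable I F T)
    (hTS : T `<=` S) (x : X) (hx : S x)
    (hloc : exists (n : nat) (N : set X) (f : 'rV[R]_n.+1 -> X),
      [/\ neighborhood_in S x N,
          homeomorphism_on (halfspace R n) N f,
          (f @` bd_halfspace R n) x
        & f @` bd_halfspace R n = N `&` T]) :
  ce_at I S x.
Proof.
case: hloc => n [N [f [hN hf [p hp fp] fT]]]; rewrite -{x}fp in hx hN *.
have [bI [C [D rCD]]] := hX.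
have hbH r : hbox p r `<=` halfspace R n by exact: hbox_halfspace.
have [r r0 Hr] := chart_open hN hf hp.
have image_avoid (A B : set 'rV[R]_n.+1) : compact A -> compact B ->
    A `<=` halfspace R n -> B `<=` halfspace R n -> A `&` B = set0 ->
    exists u, f @` A `<=` cover_by I (finset_of F u) /\
      forall y, B y -> ~ cover_by I (finset_of F u) (f y).
  move=> cA cB AH BH AB.
  have [u [Au Bu]] := compact_code_avoid hF hX (chart_compact hf AH cA)
    (chart_compact hf BH cB) (chart_disjoint hf AH BH AB).
  by exists u; split=> // y By; apply: Bu; exists y.
have [w [wS wB]] : exists w, S `\` f @` hball p r `<=` cover_by I (finset_of F w) /\
    forall y, hbox p (r / 2) y -> ~ cover_by I (finset_of F w) (f y).
  have cK : compact (S `\` f @` hball p r).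
    (* The half ball has open image in [S], so its complement in [S] is a closed part of the compact
       set [S]. *)
    have -> : S `\` f @` hball p r =
        S `&` ~` [set u | S u -> (f @` hball p r) u]^°.
      apply/seteqP; split=> u [Su nu]; split=> //.
        by move=> /interior_subset /(_ Su).
      by move=> fu; apply: nu; exact: Hr.
    apply: compact_closedI; first by case: hS.
    exact/open_closedC/open_interior.
  have cB : compact (f @` hbox p (r / 2)).
    by apply: (chart_compact hf) => //; exact: box_compact.
  have [|w [wS wB]] := compact_code_avoid hF hX cK cB.
    apply/seteqP; split=> // u [[_ nu] [y By yu]]; case: nu.
    by exists y => //; apply: (hbox_hball hp r0 _ By); lra.
  by exists w; split=> // y By; apply: wB; exists y.
(* The gap between [r / 4] and [r / 2] separates the slab to be covered from the face to be
   avoided. *)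
have /choice[gm Hgm] (k : 'I_n.+1) : exists u,
    f @` (hbox p r `&` [set y | y ord0 k <= p ord0 k + r / 4])
      `<=` cover_by I (finset_of F u) /\
    forall y, (hbox p (r / 2) `&` [set y | p ord0 k + r / 2 <= y ord0 k]) y ->
      ~ cover_by I (finset_of F u) (f y).
  apply: image_avoid; [exact: box_le_compact|exact: box_ge_compact| | |].
  - by move=> y [/hbH].
  - by move=> y [/hbH].
  - by apply/seteqP; split=> // y [[_ /= y1] [_ /= y2]]; clear -r0 y1 y2; lra.
have /choice[gp Hgp] (k : 'I_n.+1) : exists u,
    f @` (hbox p r `&` [set y | p ord0 k - r / 4 <= y ord0 k])
      `<=` cover_by I (finset_of F u) /\
    forall y, (hbox p (r / 2) `&` [set y | y ord0 k <= p ord0 k - r / 2]) y ->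
      ~ cover_by I (finset_of F u) (f y).
  apply: image_avoid; [exact: box_ge_compact|exact: box_le_compact| | |].
  - by move=> y [/hbH].
  - by move=> y [/hbH].
  - by apply/seteqP; split=> // y [[_ /= y1] [_ /= y2]]; clear -r0 y1 y2; lra.
have gmC k y : hbox p r y -> y ord0 k <= p ord0 k + r / 4 ->
    cover_by I (finset_of F (gm k)) (f y).
  by move=> By yk; apply: (Hgm k).1; exists y.
have gpC k y : hbox p r y -> p ord0 k - r / 4 <= y ord0 k ->
    cover_by I (finset_of F (gp k)) (f y).
  by move=> By yk; apply: (Hgp k).1; exists y.
have gmA k y : hbox p (r / 2) y -> p ord0 k + r / 2 <= y ord0 k ->
    ~ cover_by I (finset_of F (gm k)) (f y).
  by move=> By yk; apply: (Hgm k).2.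
have gpA k y : hbox p (r / 2) y -> y ord0 k <= p ord0 k - r / 2 ->
    ~ cover_by I (finset_of F (gp k)) (f y).
  by move=> By yk; apply: (Hgp k).2.
have NS : f @` hball p (r / 4) `<=` S.
  by move=> _ [y [Hy _] <-]; exact: (chart_sub hN hf).
(* Radius [r / 4] is what completeness of certificates requires; the certified indices form the c.e.
   set. *)
split=> //; exists (f @` hball p (r / 4)).
  split=> //; apply: Hr; first lra.
  exists p => //; split; first by rewrite /halfspace /= hp.
  by apply: ballxx; lra.
split=> //; exists (certified F I C D S T w gm gp).
  exact/ce_set_sigma1/sigma1_certified.
move=> i; split=> [iN|/certifiedP[j [t [u [v c]]]]].
  apply/certifiedP.
  exact: (certificate_complete hF bI rCD hf hp fT hTS r0 wS gmC gpC iN).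
exact: (certificate_sound bI rCD hN hf hp fT r0 wB gmA gpA c).
Qed.
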